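(* There exists a pseudo-Anosov homeomorphism of the 2-sphere $\mathbb S^2$ (with 1-prong singularities allowed) that is cw-expansive and has the shadowing property.
   Context: A continuum is a non-empty compact connected set; it is trivial if it is a single point. A homeomorphism $f\colon M\to M$ of a compact metric space $(M,\operatorname{dist})$ is cw-expansive if there is $\xi>0$ such that every continuum $C\subseteq M$ with $\operatorname{diam} f^n(C)\le\xi$ for all $n\in\mathbb Z$ is trivial. Given $\delta>0$, a sequence $(x_n)_{n\in\mathbb Z}$ in $M$ is a $\delta$-pseudo orbit of $f$ if $\operatorname{dist}(f(x_n),x_{n+1})<\delta$ for all $n\in\mathbb Z$; a point $x\in M$ $\epsilon$-shadows it if $\operatorname{dist}(f^n(x),x_n)<\epsilon$ for all $n\in\mathbb Z$. The homeomorphism $f$ has the shadowing property if for every $\epsilon>0$ there is $\delta>0$ such that every $\delta$-pseudo orbit is $\epsilon$-shadowed by some point. A homeomorphism $f$ of a closed surface is pseudo-Anosov (with 1-prongs, or spines, allowed) if there are a number $\lambda>1$ and a pair of transverse singular foliations with transverse measures, $(\mathcal F^s,\mu^s)$ and $(\mathcal F^u,\mu^u)$, having common finitely many singularities which are $p$-prong singularities with $p\ge1$, $p\neq 2$, both invariant under $f$ and with $f$ multiplying the transverse measures by $\lambda^{-1}$ and $\lambda$ respectively. *)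

(* Defs.v *)
From HB Require Import structures.
From mathcomp Require Import all_boot all_order all_algebra.
From mathcomp Require Import complex.
From mathcomp Require Import ring lra.
From mathcomp Require Import all_classical all_reals all_analysis.

Set Implicit Arguments.
Unset Strict Implicit.
Unset Printing Implicit Defensive.

Import Order.TTheory GRing.Theory Num.Theory.
Import numFieldNormedType.Exports.

Local Open Scope classical_set_scope.
Local Open Scope ring_scope.

Definition S2 (R : realType) : Type :=
  {v : 'rV[R]_3 | \sum_(i < 3) v 0 i ^+ 2 == 1}.

HB.instance Definition _ (R : realType) := Choice.copy (S2 R)
  {v : 'rV[R]_3 | \sum_(i < 3) v 0 i ^+ 2 == 1}.

Section SphereMetric.
Context {R : realType}.

Definition sphere_dist (u v : S2 R) : R :=
  Num.sqrt (\sum_(i < 3) (val u 0 i - val v 0 i) ^+ 2).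

Lemma sphere_distxx u : sphere_dist u u = 0.
Proof.
by rewrite /sphere_dist big1 ?sqrtr0 // => i _; rewrite subrr expr0n.
Qed.

Lemma sphere_dist_positivity u v : sphere_dist u v = 0 -> u = v.
Proof.
move=> /eqP; rewrite sqrtr_eq0 => le0; apply/val_inj/rowP => i.
have ge0 (j : 'I_3) : true -> 0 <= (val u 0 j - val v 0 j) ^+ 2.
  by rewrite sqr_ge0.
have /eqP : \sum_(j < 3) (val u 0 j - val v 0 j) ^+ 2 == 0.
  by rewrite eq_le le0 sumr_ge0.
move=> /(psumr_eq0P ge0) /(_ i isT) /eqP.
by rewrite sqrf_eq0 subr_eq0 => /eqP.
Qed.

Lemma sphere_dist_sym u v : sphere_dist u v = sphere_dist v u.
Proof.
rewrite /sphere_dist; congr Num.sqrt; apply: eq_bigr => i _.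
by rewrite -sqrrN opprB.
Qed.

Lemma sphere_dist_triangle v u w : sphere_dist u w <= sphere_dist u v + sphere_dist v w.
Proof.
rewrite /sphere_dist !big_ord_recl !big_ord0 !addr0.
set u0 := val u 0 _; set w0 := val w 0 _; set v0 := val v 0 _.
set u1 := val u 0 _; set w1 := val w 0 _; set v1 := val v 0 _.
set u2 := val u 0 _; set w2 := val w 0 _; set v2 := val v 0 _.
have mink (a b c x y z : R) :
    Num.sqrt ((a + x) ^+ 2 + ((b + y) ^+ 2 + (c + z) ^+ 2)) <=
    Num.sqrt (a ^+ 2 + (b ^+ 2 + c ^+ 2)) +
    Num.sqrt (x ^+ 2 + (y ^+ 2 + z ^+ 2)).
  have s1 : 0 <= a ^+ 2 + (b ^+ 2 + c ^+ 2) by rewrite !addr_ge0 ?sqr_ge0.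
  have s2 : 0 <= x ^+ 2 + (y ^+ 2 + z ^+ 2) by rewrite !addr_ge0 ?sqr_ge0.
  rewrite -(ler_pXn2r (n := 2)) ?nnegrE ?addr_ge0 ?sqrtr_ge0 //.
  rewrite sqr_sqrtr ?addr_ge0 ?sqr_ge0 // [leRHS]sqrrD !sqr_sqrtr // -sqrtrM //.
  have cs : a * x + b * y + c * z <=
      Num.sqrt ((a ^+ 2 + (b ^+ 2 + c ^+ 2)) * (x ^+ 2 + (y ^+ 2 + z ^+ 2))).
    apply: (le_trans (ler_norm _)); rewrite -sqrtr_sqr ler_wsqrtr // -subr_ge0.
    have -> : (a ^+ 2 + (b ^+ 2 + c ^+ 2)) * (x ^+ 2 + (y ^+ 2 + z ^+ 2)) -
        (a * x + b * y + c * z) ^+ 2 =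
        (a * y - b * x) ^+ 2 + (a * z - c * x) ^+ 2 + (b * z - c * y) ^+ 2.
      by ring.
    by rewrite !addr_ge0 ?sqr_ge0.
  by rewrite mulr2n; lra.
have := mink (u0 - v0) (u1 - v1) (u2 - v2) (v0 - w0) (v1 - w1) (v2 - w2).
by rewrite !addrA !subrK.
Qed.

End SphereMetric.

HB.instance Definition _ (R : realType) := @isMetric.Build R (S2 R)
  sphere_dist sphere_distxx sphere_dist_positivity sphere_dist_sym sphere_dist_triangle.

Record homeomorphism (M : topologicalType) := Homeomorphism {
  hfun :> M -> M ;
  hinv : M -> M ;
  hfunK : cancel hfun hinv ;
  hinvK : cancel hinv hfun ;
  hfun_continuous : continuous hfun ;
  hinv_continuous : continuous hinv }.

Definition iterz (M : topologicalType) (f : homeomorphism M) (n : int) : M -> M :=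
  match n with
  | Posz k => iter k f
  | Negz k => iter k.+1 (hinv f)
  end.

Section Dynamics.
Context {R : realType} {M : metricType R}.

Definition diam (C : set M) : \bar R :=
  ereal_sup [set d | exists x y, [/\ C x, C y & d = (mdist x y)%:E]].

Definition continuum (C : set M) := [/\ C !=set0, compact C & connected C].

Definition cw_expansive (f : homeomorphism M) :=
  exists2 xi : R, 0 < xi &
    forall C : set M, continuum C ->
      (forall n : int, (diam (iterz f n @` C) <= xi%:E)%E) ->
      exists x, C = [set x].

Definition pseudo_orbit (f : homeomorphism M) (delta : R) (x : int -> M) :=
  forall n : int, mdist (f (x n)) (x (n + 1)) < delta.

Definition shadows (f : homeomorphism M) (eps : R) (y : M) (x : int -> M) :=
  forall n : int, mdist (iterz f n y) (x n) < eps.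

Definition shadowing (f : homeomorphism M) :=
  forall eps : R, 0 < eps ->
    exists2 delta : R, 0 < delta &
      forall x : int -> M, pseudo_orbit f delta x -> exists y, shadows f eps y x.

End Dynamics.

Section Paths.
Context (R : realType) {T : topologicalType}.

Definition path_joined (A : set T) (x y : T) :=
  exists g : R -> T, [/\ {within `[0, 1], continuous g},
    g 0 = x, g 1 = y & g @` `[0, 1] `<=` A].

Definition path_component (A : set T) (x : T) : set T :=
  [set y | path_joined A x y].

Definition path_connected (A : set T) :=
  forall x y, A x -> A y -> path_joined A x y.

End Paths.

Section ProngModel.
Context {R : realType}.

(* With z = z.1 + i z.2, |z|^p - Re (z^p) = 2 (Im z^(p/2))^2 and
   |z|^p + Re (z^p) = 2 (Re z^(p/2))^2, where the sign ambiguity of z^(p/2) for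
   odd p has disappeared.  Away from the origin, the components of the level
   sets are the leaves of the horizontal, resp. vertical, foliation of the
   quadratic differential z^(p-2) dz^2 (up to a constant factor), that is, of
   the standard p-prong saddle.  For p = 1 these are two families of confocal
   parabolas; for p = 2 they are the horizontal and the vertical lines. *)
Definition prong_h (p : nat) (z : R * R) : R :=
  Num.sqrt (z.1 ^+ 2 + z.2 ^+ 2) ^+ p - complex.Re ((Complex z.1 z.2) ^+ p).

Definition prong_v (p : nat) (z : R * R) : R :=
  Num.sqrt (z.1 ^+ 2 + z.2 ^+ 2) ^+ p + complex.Re ((Complex z.1 z.2) ^+ p).

End ProngModel.

Section Foliations.
Context {R : realType} {M : topologicalType}.
Implicit Types (S U : set M) (F : set (set M)) (phi : M -> R * R).
Implicit Types (alpha : R -> M) (mu : (R -> M) -> R).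

(* phi restricts to a homeomorphism of U onto an open subset of the plane; its
   values outside U are irrelevant. *)
Definition chart U phi :=
  [/\ open U, set_inj U phi, (forall x, U x -> {for x, continuous phi}) &
      forall V : set M, open V -> V `<=` U -> open (phi @` V)].

(* phi carries each plaque (path component of the trace on U of a leaf) onto a
   path component of a level set of h, in the image of U minus the
   singularities. *)
Definition straightens S F U phi (h : R * R -> R) :=
  forall (L : set M) (x : M), F L -> (L `&` U) x ->
    path_component R (L `&` U) x =
    U `&` phi @^-1` path_component R
      (phi @` (U `\` S) `&` [set z | h z = h (phi x)]) (phi x).

Definition regular_chart S F U phi :=
  [/\ chart U phi, U `&` S = set0 & straightens S F U phi snd].

Definition prong_chart S F (p : nat) (x : M) U phi :=
  [/\ chart U phi, U `&` S = [set x], phi x = (0, 0) &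
      straightens S F U phi (prong_h p)].

(* F is the set of leaves: they partition the complement of the set S of
   singularities, so that the separatrices issuing from a singularity are
   distinct leaves (unless they coincide globally). *)
Definition singular_foliation S F :=
  [/\ partition F id (~` S),
      (forall L, F L -> path_connected R L),
      (forall x, ~ S x -> exists U phi, U x /\ regular_chart S F U phi) &
      (forall x, S x -> exists (p : nat) U phi,
         [/\ (1 <= p)%N, p <> 2%N & prong_chart S F p x U phi])].

Definition transverse_foliations S Fs Fu :=
  (forall x, ~ S x -> exists U phi,
     [/\ U x, regular_chart S Fs U phi & straightens S Fu U phi fst]) /\
  (forall x, S x -> exists (p : nat) U phi,
     [/\ (1 <= p)%N, p <> 2%N, prong_chart S Fs p x U phi &
         straightens S Fu U phi (prong_v p)]).

(* Topological transversality: locally, alpha meets each plaque at most once.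
   Arcs are parametrized by [0, 1]. *)
Definition transverse_arc S F alpha :=
  {within `[0, 1], continuous alpha} /\
  forall t : R, `[0, 1]%classic t -> exists U phi (V : set R),
    [/\ regular_chart S F U phi, U (alpha t), nbhs t V &
        set_inj (V `&` `[0, 1]) (fun s => (phi (alpha s)).2)].

Definition subarc alpha (a b : R) : R -> M := fun t => alpha (a + (b - a) * t).

(* A transverse measure assigns a length to every transverse arc; it is
   positive, additive, invariant under isotopies of transverse arcs moving each
   point inside a leaf, and locally equal to |dy| in suitable charts. *)
Definition transverse_measure S F mu :=
  [/\ (forall alpha, transverse_arc S F alpha -> 0 < mu alpha),
      (forall alpha (c : R), transverse_arc S F alpha -> 0 < c -> c < 1 ->
         mu alpha = mu (subarc alpha 0 c) + mu (subarc alpha c 1)),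
      (forall H : R * R -> M,
         {within `[0, 1] `*` `[0, 1], continuous H} ->
         (forall t : R, `[0, 1]%classic t ->
            transverse_arc S F (fun s => H (s, t))) ->
         (forall s : R, `[0, 1]%classic s ->
            exists2 L, F L & forall t : R, `[0, 1]%classic t -> L (H (s, t))) ->
         mu (fun s => H (s, 0)) = mu (fun s => H (s, 1))) &
      (forall x, ~ S x -> exists U phi,
         [/\ U x, regular_chart S F U phi &
             forall alpha, transverse_arc S F alpha ->
               alpha @` `[0, 1] `<=` U ->
               set_inj `[0, 1] (fun s => (phi (alpha s)).2) ->
               mu alpha = `|(phi (alpha 1)).2 - (phi (alpha 0)).2|])].

(* A homeomorphism acts on measured foliations by pushforward,
   f (F, mu) = (f F, f_* mu) with (f_* mu) alpha = mu (f^-1 o alpha); thus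
   f (Fs, mus) = (Fs, lambda^-1 mus) and f (Fu, muu) = (Fu, lambda muu). *)
Definition pseudo_anosov (f : homeomorphism M) :=
  exists (lambda : R) (S : set M) (Fs Fu : set (set M))
         (mus muu : (R -> M) -> R),
    [/\ 1 < lambda,
        finite_set S,
        singular_foliation S Fs /\ transverse_measure S Fs mus,
        singular_foliation S Fu /\ transverse_measure S Fu muu &
        transverse_foliations S Fs Fu] /\
    [/\ [set f @` L | L in Fs] = Fs,
        [set f @` L | L in Fu] = Fu,
        (forall alpha, transverse_arc S Fs alpha ->
           mus (hinv f \o alpha) = lambda^-1 * mus alpha) &
        (forall alpha, transverse_arc S Fu alpha ->
           muu (hinv f \o alpha) = lambda * muu alpha)].

End Foliations.

(* Main.v *)
Require Import Defs.
From mathcomp Require Import all_boot all_order all_algebra.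
From mathcomp Require Import ring lra.
From mathcomp Require Import all_classical all_reals all_analysis.

Set Implicit Arguments.
Unset Strict Implicit.
Unset Printing Implicit Defensive.

Import Order.TTheory GRing.Theory Num.Theory.
Import numFieldNormedType.Exports.

Local Open Scope classical_set_scope.
Local Open Scope ring_scope.

(** The homeomorphism is the quotient of a linear map of the plane.  Let [A] be
the hyperbolic matrix with rows (1, 2) and (1, 1).  It commutes with [- 1] and
preserves the lattice [2 pi Z ^ 2], so it acts on the quotient of the plane by
the translations of this lattice and by [z |-> - z].  This quotient is a torus
modulo its hyperelliptic involution, a sphere with four cone points of angle
[pi].  The homeomorphism with the round sphere is explicit: the map
[(cos x, cos y, sin x sin y)] is invariant under the group and parametrizes a
pillow-shaped surface, star-shaped with respect to the origin, which is
projected radially to the sphere ([pillow_fiber], [pillow_surj] and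
[sphere_flat_cover]).

In the eigencoordinates of [A] the invariant foliations upstairs are those by
horizontal and by vertical lines.  They descend to the sphere.  Near a cone
point the quotient by a point reflection is complex squaring, which turns
horizontal lines into the level sets of the one-prong model, so the four cone
points are one-prong singularities and there are no others
([leaves_singular_foliation], [leaves_transverse]).  The eigenlines are
irrational, so a leaf meets a chart in countably many plaques, and a continuous
function with countably many values on an interval is constant
([countable_range_const], [straightens_intro]): this identifies the path
components that the definitions of charts refer to.  The transverse measure of
an arc is the variation of the relevant eigencoordinate along a lift of the arc
to the plane ([path_lifting], [lifted_height]).  Transversality makes this
coordinate strictly monotone ([transverse_height_inj]), whence positivity and
additivity; the isotopy invariance is [isotopy_lifted_height].  The matrix
multiplies the two coordinates by [1 - sqrt 2] and [1 + sqrt 2], whose absolute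
values are inverse to each other, so the dilatation is [1 + sqrt 2].  Everything
is done for the horizontal foliation of an abstract cover ([flat_cover]) and
transferred to the vertical one by exchanging the coordinates.

Expansivity and shadowing come from the linear map through [close_lift]: nearby
points of the sphere have nearby lifts.  A pseudo orbit therefore lifts to a
pseudo orbit of a hyperbolic linear map, which is shadowed coordinate by
coordinate, and the projection of the shadowing orbit shadows the original one
([cover_shadowing]).  Expansivity fails for points, as the two lifts of a point
close to a cone point can be exchanged at each passage, but it holds for
continua: if all the iterates of a connected set are small, the closeness of
lifts propagates along the set ([fiber_trap]), which therefore has lifts
with all iterates in small regions and is a point ([cover_cw_expansive]). *)

(** * Functions on a real interval *)

Section RealLine.
Context {R : realType}.
Implicit Types (a b t : R) (k : R -> R).

(** Precomposition with [clamp a b] turns a function that is continuous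
within [a, b] into a globally continuous one with the same values on [a, b], so
that arcs and isotopies can be handled as maps on the line or the plane. *)
Definition clamp a b t : R := Num.max a (Num.min b t).

Lemma clamp_in a b t : a <= b -> a <= clamp a b t <= b.
Proof.
by move=> ab; rewrite /clamp le_max lexx /= ge_max ab ge_min lexx.
Qed.

Lemma clamp_id a b t : a <= t <= b -> clamp a b t = t.
Proof.
by move=> /andP[at_ tb]; rewrite /clamp (min_idPr tb) (max_idPr at_).
Qed.

Lemma clamp_continuous a b : continuous (clamp a b).
Proof.
move=> t; apply: continuous_max; first exact: cvg_cst.
by apply: continuous_min; [exact: cvg_cst | exact: cvg_id].
Qed.

Lemma clamp_extension (T : topologicalType) a b (g : R -> T) : a <= b ->
  {within `[a, b], continuous g} -> continuous (g \o clamp a b).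
Proof.
move=> ab cg t.
have ct : `[a, b]%classic (clamp a b t) by rewrite /= in_itv /= clamp_in.
have := cg (clamp a b t); rewrite /prop_for /continuous_at => cgt.
move=> W /= /cgt; rewrite /from_subspace /= => h.
have : within `[a, b] (nbhs (clamp a b t)) [set s | W (g s)].
  by rewrite (nbhs_subspace_in ct).
rewrite /within /= => h2.
have h3 : nbhs t [set s | clamp a b s \in `[a, b] -> W (g (clamp a b s))].
  exact: (@clamp_continuous a b t _ h2).
suff : nbhs t [set s | W (g (clamp a b s))] by [].
apply: filterS h3 => s /=; apply.
by rewrite /= in_itv /= clamp_in.
Qed.

(** By the intermediate value theorem a non-constant
continuous function takes a whole interval of values, which has positive
Lebesgue measure, whereas a countable set is null.  This is what keeps a path
inside a leaf on a single plaque: a leaf meets a chart in countably many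
plaques. *)
Lemma countable_range_const (D : set R) a b k : a <= b -> countable D ->
  {within `[a, b], continuous k} -> (forall t, a <= t <= b -> D (k t)) ->
  k a = k b.
Proof.
move=> ab cD ck kD; apply: contrapT => /eqP kab.
set m := Num.min (k a) (k b); set M := Num.max (k a) (k b).
have mM : m < M.
  by rewrite /m /M lt_max !gt_min !ltxx /= orbF orbC -neq_lt.
have sub : `[m, M] `<=` D.
  move=> v; rewrite /= in_itv /= => vm.
  have [c] := IVT ab ck vm; rewrite in_itv /= => cab <-; exact: kD.
have := countable_lebesgue_measure0 (sub_countable (subset_card_le sub) cD).
rewrite lebesgue_measure_itv /= lte_fin mM => /eqP.
by rewrite -EFinB eqe subr_eq0 => /eqP e; move: mM; rewrite e ltxx.
Qed.

(** Connectedness of a segment in the form of an induction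
principle: the supremum of the points where [Q] holds is reached, and the step
at that point would go beyond it. *)
Lemma segment_induction a b (Q : R -> Prop) : a <= b -> Q a ->
  (forall t, a <= t <= b -> exists2 e, 0 < e &
     forall s s', a <= s <= b -> a <= s' <= b -> s <= s' ->
       `|s - t| < e -> `|s' - t| < e -> Q s -> Q s') ->
  Q b.
Proof.
move=> ab Qa step.
pose A : set R := [set t | a <= t <= b /\ Q t].
have Aa : A a by split=> //; rewrite lexx.
have hsA : has_sup A.
  by split; [exists a | exists b => t [/andP[]]].
set c := sup A.
have ac : a <= c by apply: ub_le_sup => //; case: hsA.
have cb : c <= b by apply: ge_sup; [exists a | move=> t [/andP[]]].
have [e e0 he] := step c ltac:(by rewrite ac cb).
have [s [/andP[as_ sb] Qs] cs] := sup_adherent e0 hsA.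
have sc : s <= c by apply: ub_le_sup; [case: hsA | split=> //; rewrite as_].
have ncs : `|s - c| < e.
  by rewrite distrC ger0_norm ?subr_ge0 // ltrBlDl -ltrBlDr.
have Qc : Q c.
  by apply: (he s c) => //; rewrite ?as_ ?ac // subrr normr0.
suff -> : b = c by [].
apply/eqP; rewrite eq_le cb andbT leNgt; apply/negP => clt.
set s' := Num.min b (c + e / 2).
have cs' : c < s' by rewrite lt_min clt ltrDl divr_gt0.
have s'b : s' <= b by rewrite ge_min lexx.
have : A s'.
  have as' : a <= s' <= b by rewrite s'b andbT (le_trans ac) // ltW.
  split=> //; apply: (he c s') => //; rewrite ?ac // ?subrr ?normr0 // ?(ltW cs') //.
  rewrite ger0_norm ?subr_ge0 ?(ltW cs') // ltrBlDl.
  by rewrite /s' gt_min; apply/orP; right; rewrite ltrD2l gtr_pMr // invf_lt1 // ltr1n.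
move=> /(ub_le_sup (proj2 hsA)); rewrite -/c => h.
by move: cs'; rewrite ltNge h.
Qed.

(** On a small interval around [c] injectivity makes [k]
strictly monotone, hence larger than [k c] on one of the two sides. *)
Lemma locally_inj_no_max k a b c : a < c < b ->
  {within `[a, b], continuous k} ->
  (exists2 V, nbhs c V & set_inj (V `&` `[a, b]) k) ->
  ~ (forall t, a <= t <= b -> k t <= k c).
Proof.
move=> /andP[ac cb] ck [V Vc kV] kc.
move/nbhs_ballP: Vc => [e /= e0 eV].
set d := Num.min (e / 2) (Num.min (c - a) (b - c)).
have d0 : 0 < d by rewrite !lt_min !subr_gt0 ac cb divr_gt0.
have de : d < e by rewrite gt_min ltr_pdivrMr // ltr_pMr // ltr1n.
have da : d <= c - a by rewrite !ge_min lexx orbT.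
have db : d <= b - c by rewrite !ge_min lexx !orbT.
have sub : `[c - d, c + d] `<=` `[a, b].
  by move=> t /=; rewrite !in_itv /= => /andP[h1 h2]; apply/andP; split; lra.
have inj : {in `[c - d, c + d] &, injective k}.
  move=> x y xI yI kxy; apply: kV => //; rewrite in_setE; split;
    try exact: sub; apply: eV; rewrite /ball /=;
    move: xI yI; rewrite !in_itv /= => /andP[? ?] /andP[? ?];
    rewrite ltr_norml; apply/andP; split; lra.
have i1 : c - d \in `[c - d, c + d] by rewrite in_itv /=; apply/andP; split; lra.
have i2 : c \in `[c - d, c + d] by rewrite in_itv /=; apply/andP; split; lra.
have i3 : c + d \in `[c - d, c + d] by rewrite in_itv /=; apply/andP; split; lra.
have := itv_continuous_inj_mono (continuous_subspaceW sub ck) inj.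
case=> mono.
- have /mono : c < c + d by rewrite ltrDl.
  by move=> /(_ i2 i3); rewrite ltNge kc //; apply/andP; split; lra.
- have /mono : c - d < c by lra.
  by move=> /(_ i2 i1); rewrite ltNge kc //; apply/andP; split; lra.
Qed.

(** If [k x = k y], the extrema of [k] on [[x, y]] cannot be
interior, so both are equal to [k x] and [k] is constant on [[x, y]], which
contradicts local injectivity at the middle.  Topological transversality is
local; this lemma makes it global. *)
Lemma locally_inj_inj k a b :
  {within `[a, b], continuous k} ->
  (forall t, a <= t <= b ->
     exists2 V, nbhs t V & set_inj (V `&` `[a, b]) k) ->
  {in `[a, b] &, injective k}.
Proof.
move=> ck lk.
suff noeq x y : a <= x -> y <= b -> x < y -> k x <> k y.
  move=> x y; rewrite !in_itv /= => /andP[ax xb] /andP[ay yb] kxy.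
  have [xy|yx|//] := ltgtP x y; first by case: (noeq x y).
  by case: (noeq y x).
move=> ax yb xy kxy.
have sub : `[x, y] `<=` `[a, b].
  by move=> t /=; rewrite !in_itv /= => /andP[h1 h2]; apply/andP; split; lra.
have ck' := continuous_subspaceW sub ck.
have lk' t : x <= t <= y -> exists2 V, nbhs t V & set_inj (V `&` `[x, y]) k.
  move=> /andP[xt ty]; have [|V nV iV] := lk t; first by apply/andP; split; lra.
  exists V => // u v; rewrite !in_setE => -[Vu ui] [Vv vi]; apply: iV; rewrite in_setE;
    split=> //; exact: sub.
have [c /[!in_itv]/= cI cM] := EVT_max (ltW xy) ck'.
have [d /[!in_itv]/= dI dM] := EVT_min (ltW xy) ck'.
have kcx : k c = k x.
  have [/eqP cx|nx] := boolP (c == x); first by rewrite cx.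
  have [/eqP cy|ny] := boolP (c == y); first by rewrite cy kxy.
  exfalso; apply: (@locally_inj_no_max k x y c _ ck' (lk' _ cI)) => //.
  by case/andP: cI => ? ?; rewrite !lt_neqAle eq_sym nx ny; apply/andP.
have kdx : k d = k x.
  have [/eqP cx|nx] := boolP (d == x); first by rewrite cx.
  have [/eqP cy|ny] := boolP (d == y); first by rewrite cy kxy.
  exfalso; apply: (@locally_inj_no_max (- k) x y d _ _ _).
  - by case/andP: dI => ? ?; rewrite !lt_neqAle eq_sym nx ny; apply/andP.
  - by move=> t; apply: cvgN; exact: ck'.
  - have [V nV iV] := lk' _ dI; exists V => // u v uI vI /= /oppr_inj; exact: iV.
  - by move=> t tI; rewrite lerN2 dM // in_itv.
have mI : x < (x + y) / 2 < y by apply/andP; split; lra.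
apply: (@locally_inj_no_max k x y _ mI ck') => [|t tI].
  by apply: lk'; case/andP: mI => ? ?; apply/andP; split; lra.
have mI' : x <= (x + y) / 2 <= y by case/andP: mI => ? ?; apply/andP; split; lra.
by rewrite (le_trans (cM _ _)) // kcx -kdx dM.
Qed.

Lemma pair_continuous (T : topologicalType) (f g : T -> R) (x : T) :
  {for x, continuous f} -> {for x, continuous g} ->
  {for x, continuous (fun y => (f y, g y))}.
Proof. by move=> cf cg; exact: (cvg_pair cf cg). Qed.

End RealLine.

(** * The plane as a branched cover *)

Section FlatCover.
Context {R : realType}.
Local Notation plane := (R * R)%type.

(** The fixed points of the point reflections [z |-> v - z], [v]
in [L]. *)
Definition half_lattice (L : set plane) : set plane := [set z | L (z + z)].

(** [p] presents [M] as the quotient of the plane by the group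
generated by the translations of the discrete group [L] and by [z |-> - z]; for
a lattice this is a flat torus modulo its hyperelliptic involution.  The branch points of [p] form the
half lattice, and their images are the cone points of [M].  The coordinate
axes contain no nonzero lattice vector; this makes the horizontal and the
vertical lines of the plane project to foliations without compact leaf.  All
the axioms are symmetric in the two coordinates. *)
Record flat_cover (M : topologicalType) (L : set plane) (c : R) (p : plane -> M)
    : Prop := FlatCover {
  lat0 : L 0 ;
  latB : forall v w, L v -> L w -> L (v - w) ;
  lat_countable : countable L ;
  lat_gap_gt0 : 0 < c ;
  lat_gap : forall v, L v -> `|v| < c -> v = 0 ;
  lat_irr1 : forall v, L v -> v.1 = 0 -> v = 0 ;
  lat_irr2 : forall v, L v -> v.2 = 0 -> v = 0 ;
  cover_continuous : continuous p ;
  cover_surj : forall x, exists z, p z = x ;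
  cover_open : forall V, open V -> open (p @` V) ;
  cover_fiber : forall z w, p z = p w <-> L (w - z) \/ L (w + z) ;
  cone_finite : finite_set (p @` half_lattice L) }.

Context {M : topologicalType} {L : set plane} {c : R} {p : plane -> M}.
Hypothesis pC : flat_cover L c p.
Local Notation P := (half_lattice L).
Local Notation S := (p @` P).

Lemma latN v : L v -> L (- v).
Proof. by move=> Lv; rewrite -sub0r; apply: (latB pC) => //; exact: lat0 pC. Qed.

Lemma latD v w : L v -> L w -> L (v + w).
Proof. by move=> Lv Lw; rewrite -[w]opprK; apply: (latB pC) => //; exact: latN. Qed.

Lemma half_lattice_fiber z w : p z = p w -> P z -> P w.
Proof.
move=> /(cover_fiber pC)[h|h] Pz; rewrite /half_lattice /=.
- have -> : w + w = (w - z) + (w - z) + (z + z) by rewrite addrACA !subrK.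
  by apply: latD => //; exact: latD.
- have -> : w + w = (w + z) + (w + z) - (z + z) by rewrite opprD addrACA !addrK.
  by apply: (latB pC) => //; exact: latD.
Qed.

Lemma coneP z : S (p z) <-> P z.
Proof.
split=> [[w Pw pw]|Pz]; last by exists z.
exact: half_lattice_fiber Pw.
Qed.

Definition midpoint (z w : plane) : plane := 2^-1 *: (z + w).

Lemma half_half (z : plane) : 2^-1 *: z + 2^-1 *: z = z.
Proof. by rewrite -scalerDl -mulr2n -[2^-1 *+ 2]mulr_natr mulVf ?scale1r // pnatr_eq0. Qed.

Lemma midpointD z w : midpoint z w + midpoint z w = z + w.
Proof. exact: half_half. Qed.

(** Two points of a fiber differ by a lattice vector, which is
zero if it is short, or are exchanged by a point reflection, whose center is
their midpoint. *)
Lemma fiber_separated z w :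
  p z = p w -> `|w - z| < c -> ~ P (midpoint z w) -> w = z.
Proof.
move=> /(cover_fiber pC)[h|h] wz nP.
- by apply/eqP; rewrite -subr_eq0; apply/eqP; exact: (lat_gap pC).
- by case: nP; rewrite /half_lattice /= midpointD addrC.
Qed.

(** Twice the difference of two half-lattice points is a lattice
vector. *)
Lemma half_lattice_gap z w : P z -> P w -> `|w - z| + `|w - z| < c -> w = z.
Proof.
move=> Pz Pw wz; have h : w - z + (w - z) = 0.
  apply: (lat_gap pC); last exact: le_lt_trans (ler_normD _ _) wz.
  by rewrite addrACA -opprD; exact: (latB pC).
apply/eqP; rewrite -subr_eq0; move/eqP: h.
by rewrite -mulr2n -scaler_nat scaler_eq0 pnatr_eq0.
Qed.

(** [p] is injective on the ball of radius [r] around [z], by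
[fiber_separated]. *)
Definition away (r : R) (z : plane) :=
  [/\ 0 < r, r + r <= c & forall v, `|v - z| < r -> ~ P v].

(** By [half_lattice_gap] there is at most one point of the half
lattice within [c / 4] of [z]; its distance to [z] can serve as the radius. *)
Lemma away_exists z : ~ P z -> exists r, away r z.
Proof.
move=> nPz; have c0 := lat_gap_gt0 pC.
have c4 : 0 < c / 4 by rewrite divr_gt0.
have [[v [Pv vz]]|h] := pselect (exists v, P v /\ `|v - z| < c / 4); last first.
  exists (c / 4); split=> //; first by lra.
  by move=> v vz Pv; apply: h; exists v.
exists `|v - z|; split.
- by rewrite normr_gt0 subr_eq0; apply/eqP => vz0; apply: nPz; rewrite -vz0.
- by lra.
- move=> w wz Pw; move: (wz); rewrite (@half_lattice_gap v w) ?ltxx //.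
  have : `|w - v| <= `|w - z| + `|v - z| by rewrite (distrC v z) ler_distD.
  by lra.
Qed.

Lemma away_ball r z w : away r z -> `|w - z| <= r / 2 -> away (r / 2) w.
Proof.
move=> [r0 rc h] wz; split; [by lra | by lra | move=> v vw; apply: h].
have := ler_distD w v z; lra.
Qed.

Lemma away_inj r z v w : away r z -> `|v - z| < r -> `|w - z| < r ->
  p v = p w -> v = w.
Proof.
move=> [r0 rc h] vz wz pvw; symmetry; apply: fiber_separated => //.
  by have := ler_distD z w v; rewrite (distrC z v); lra.
apply: h.
have -> : midpoint v w - z = 2^-1 *: ((v - z) + (w - z)).
  rewrite /midpoint addrACA -opprD scalerBr; congr (_ - _).
  by rewrite scalerDr; exact/esym/half_half.
rewrite normrZ ger0_norm ?invr_ge0 ?ler0n //.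
by have := ler_normD (v - z) (w - z); lra.
Qed.

Lemma nbhs_plane (z : plane) (W : set plane) :
  nbhs z W <-> exists2 e : R, 0 < e & forall w, `|w - z| < e -> W w.
Proof.
split=> [/nbhs_ballP[e /= e0 h]|[e e0 h]].
  by exists e => // w wz; apply: h; rewrite -ball_normE /ball_ /= distrC.
apply/nbhs_ballP; exists e => //= w; rewrite -ball_normE /ball_ /= distrC.
exact: h.
Qed.

(** The ball with its center on the right of the difference, which is
the form in which distances to a point occur below. *)
Definition dball (z : plane) (r : R) : set plane := [set w | `|w - z| < r].

Lemma open_dball (z : plane) (r : R) : open (dball z r).
Proof.
suff -> : dball z r = ball z r by exact: ball_open.
by apply/seteqP; split=> w; rewrite -ball_normE /ball_ /dball /= distrC.
Qed.

Lemma cover_nbhs (z : plane) (W : set plane) : nbhs z W -> nbhs (p z) (p @` W).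
Proof.
move=> /nbhs_plane[e e0 eW].
have : nbhs (p z) (p @` [set w | `|w - z| < e]).
  apply: open_nbhs_nbhs; split; first by apply: (cover_open pC); exact: open_dball.
  by exists z => //=; rewrite subrr normr0.
by apply: filterS; exact: image_subset.
Qed.

(** The cover is an open map. *)
Lemma cover_descends (T : topologicalType) (f : M -> T) (z : plane) :
  {for z, continuous (f \o p)} -> {for p z, continuous f}.
Proof.
move=> cf W /cf /cover_nbhs; apply: filterS => x [w Ww <-].
exact: Ww.
Qed.

(** A lift that stays in a ball on which [p] is injective is
continuous, because [p] is open.  The lifts of paths and of isotopies are built
pointwise and get their continuity from this lemma. *)
Lemma nearby_lift_continuous (X : topologicalType) (K : X -> M) (G : X -> plane)
    (x : X) (r : R) (z : plane) :
  away r z -> {for x, continuous K} ->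
  p (G x) = K x -> `|G x - z| < r ->
  (\forall y \near x, p (G y) = K y /\ `|G y - z| < r) ->
  {for x, continuous G}.
Proof.
move=> az cK pGx Gxz near_G W /= nW.
have nW' : nbhs (G x) (W `&` [set w | `|w - z| < r]).
  apply: filterI => //; apply: open_nbhs_nbhs; split => //; exact: open_dball.
have := cover_nbhs nW'; rewrite pGx => /cK nK.
suff : nbhs x [set y | W (G y)] by [].
near=> y.
have [w [Ww wz] pw] : (p @` (W `&` [set w | `|w - z| < r])) (K y).
  by near: y; exact: nK.
have [pGy Gyz] : p (G y) = K y /\ `|G y - z| < r by near: y.
by rewrite /= (_ : G y = w) //; apply: (away_inj az) => //; rewrite pGy pw.
Unshelve. all: by end_near. Qed.

Definition lifts_path (g : R -> plane) (alpha : R -> M) :=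
  continuous g /\ forall t : R, 0 <= t <= 1 -> p (g t) = alpha t.

(** Away from the cone points [p] is a covering map.  The set of
times up to which a lift exists is propagated by [segment_induction]: near each
time the path runs in an evenly covered ball, where it has a lift [k], and [k]
is attached to the given lift [g] by a deck transformation, that is by adding
the increments of [k] or of [- k] to [g]. *)
Lemma path_lifting (alpha : R -> M) : continuous alpha ->
  (forall t : R, 0 <= t <= 1 -> ~ S (alpha t)) -> exists g, lifts_path g alpha.
Proof.
move=> ca aS.
pose Q (t : R) := exists2 g : R -> plane, continuous g &
  forall s : R, 0 <= s <= t -> p (g s) = alpha s.
suff [g cg gQ] : Q 1 by exists g.
apply: (@segment_induction _ 0) => //.
  have [z zE] := cover_surj pC (alpha 0).
  exists (fun=> z); first by move=> ?; exact: cvg_cst.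
  by move=> s /andP[s0 s1]; rewrite zE; congr alpha; apply/eqP; rewrite eq_le s0 s1.
move=> t tI; have [z zE] := cover_surj pC (alpha t).
have nPz : ~ P z by move/coneP; rewrite zE; exact: aS.
have [r az] := away_exists nPz; have r0 : 0 < r by case: az.
have [e /= e0 he] : nbhs_ball t [set s | exists2 w : plane, `|w - z| < r & p w = alpha s].
  apply/nbhs_ballP; have nz : nbhs z [set w | `|w - z| < r].
    by apply: open_nbhs_nbhs; split; [exact: open_dball | rewrite /= subrr normr0].
  have := cover_nbhs nz; rewrite zE => nz'.
  have nt : nbhs t [set s | (p @` [set w | `|w - z| < r]) (alpha s)] := ca t _ nz'.
  by apply: filterS nt => s [w wz pw]; exists w.
exists e => // s s' /andP[s0 s1] /andP[s0' s1'] ss' st s't [g cg gl].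
pose k (u : R) := xget z [set w | `|w - z| < r /\ p w = alpha u].
have kE u : s <= u <= s' -> `|k u - z| < r /\ p (k u) = alpha u.
  move=> /andP[su us'].
  have : ball t e u.
    move: st s't; rewrite /ball /= !ltr_norml => /andP[? ?] /andP[? ?].
    by apply/andP; split; lra.
  move=> /he[w wz pw]; rewrite /k; case: xgetP => [v _ //|/(_ w)].
  by move=> h; case: h; split.
have ck : continuous (k \o clamp s s').
  move=> u; apply: (nearby_lift_continuous (K := alpha \o clamp s s') az).
  - by apply: continuous_comp; [exact: clamp_continuous | exact: ca].
  - by have [] := kE (clamp s s' u) (clamp_in _ ss').
  - by have [] := kE (clamp s s' u) (clamp_in _ ss').
  - by near=> v; have [] := kE (clamp s s' v) (clamp_in _ ss').
have kss : p (k s) = p (g s).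
  by rewrite gl ?lexx ?s0 // (kE s _).2 // lexx ss'.
have cgm : continuous (fun u => g (Num.min s u)).
  move=> u; apply: (@continuous_comp _ _ _ (fun u => Num.min s u) g).
    by apply: continuous_min; [exact: cvg_cst | exact: cvg_id].
  exact: cg.
have split_le u : 0 <= u <= s' -> (0 <= u <= s) \/ (s <= u <= s').
  by move=> /andP[-> us']; case: (leP u s) => us; [left | right; rewrite us' ltW].
case/(cover_fiber pC): kss => h.
- exists (fun u => g (Num.min s u) + (k (clamp s s' u) - k s)).
    move=> u; apply: cvgD; first exact: cgm.
    by apply: cvgB; [exact: ck | exact: cvg_cst].
  move=> u /split_le[/andP[u0 us]|/andP[su us']].
    rewrite (min_idPr us) (_ : clamp s s' u = s); last first.
      by rewrite /clamp (min_idPr (le_trans us ss')) (max_idPl us).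
    by rewrite subrr addr0 gl // u0.
  have uI : s <= u <= s' by rewrite su.
  rewrite (min_idPl su) clamp_id // -(kE u uI).2.
  by symmetry; apply/(cover_fiber pC); left; rewrite addrA addrAC addrK.
- exists (fun u => g (Num.min s u) - (k (clamp s s' u) - k s)).
    move=> u; apply: cvgB; first exact: cgm.
    by apply: cvgB; [exact: ck | exact: cvg_cst].
  move=> u /split_le[/andP[u0 us]|/andP[su us']].
    rewrite (min_idPr us) (_ : clamp s s' u = s); last first.
      by rewrite /clamp (min_idPr (le_trans us ss')) (max_idPl us).
    by rewrite subrr subr0 gl // u0.
  have uI : s <= u <= s' by rewrite su.
  rewrite (min_idPl su) clamp_id // -(kE u uI).2.
  by symmetry; apply/(cover_fiber pC); right; rewrite opprB addrA addrNK.
Unshelve. all: by end_near. Qed.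

(** Two lifts that agree at some time stay close, and nearby points
of a fiber are equal away from the half lattice. *)
Lemma lift_unique (g h : R -> plane) (alpha : R -> M) :
  lifts_path g alpha -> lifts_path h alpha ->
  (forall t : R, 0 <= t <= 1 -> ~ S (alpha t)) -> g 0 = h 0 -> g 1 = h 1.
Proof.
move=> [cg gl] [ch hl] aS gh0.
apply: (@segment_induction _ 0 1 (fun t => g t = h t)) => // t tI.
have nPh : ~ P (h t) by move/coneP; rewrite hl //; exact: aS.
have [r az] := away_exists nPh.
have r4 : 0 < r / 4 by case: az => r0 _ _; rewrite divr_gt0.
have ng : nbhs t [set s | `|g s - g t| < r / 4].
  by apply: (cg t [set w | `|w - g t| < r / 4]); apply/nbhs_plane; exists (r / 4).
have nh : nbhs t [set s | `|h s - h t| < r / 4].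
  by apply: (ch t [set w | `|w - h t| < r / 4]); apply/nbhs_plane; exists (r / 4).
have [e /= e0 he] := iffLR (nbhs_ballP _ _) (filterI ng nh).
exists e => // s s' sI s'I ss' st s't ghs.
have [gs hs] := he s ltac:(by rewrite /ball /= distrC).
have [gs' hs'] := he s' ltac:(by rewrite /ball /= distrC).
move: gs hs gs' hs' => /=; rewrite ghs => gs hs gs' hs'.
apply: (away_inj az); rewrite ?gl ?hl //; last by lra.
have h1 := ler_distD (g t) (g s') (h t).
have h2 := ler_distD (h s) (g t) (h t).
by rewrite (distrC (g t) (h s)) in h2; lra.
Qed.

(** The candidate for the transverse measure of the horizontal
foliation: the height difference between the ends of a lift.  The value 0
is for arcs without lift. *)
Definition lifted_height (alpha : R -> M) : R :=
  match pselect (exists g, lifts_path g alpha) with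
  | left h => `|(projT1 (cid h) 1).2 - (projT1 (cid h) 0).2|
  | right _ => 0
  end.

(** Two lifts of an arc differ by a deck transformation, which is a
translation or a point reflection and so preserves height differences up to
sign. *)
Lemma lifted_heightE (g : R -> plane) (alpha : R -> M) : lifts_path g alpha ->
  (forall t : R, 0 <= t <= 1 -> ~ S (alpha t)) ->
  lifted_height alpha = `|(g 1).2 - (g 0).2|.
Proof.
move=> gl aS; rewrite /lifted_height; case: pselect => [ex|]; last by case; exists g.
case: cid => h /= hl.
have : p (g 0) = p (h 0) by rewrite gl.2 ?hl.2 // lexx ler01.
case/(cover_fiber pC) => Lv.
- have l2 : lifts_path (fun t => (h 0 - g 0) + g t) alpha.
    split; first by move=> t; apply: cvgD; [exact: cvg_cst | exact: gl.1].
    move=> t tI; rewrite -gl.2 //; symmetry; apply/(cover_fiber pC); left.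
    by rewrite addrK.
  rewrite (lift_unique hl l2) //; last by rewrite subrK.
  by congr (`| _ |); rewrite /=; ring.
- have l2 : lifts_path (fun t => (h 0 + g 0) - g t) alpha.
    split; first by move=> t; apply: cvgB; [exact: cvg_cst | exact: gl.1].
    move=> t tI; rewrite -gl.2 //; symmetry; apply/(cover_fiber pC); right.
    by rewrite subrK.
  rewrite (lift_unique hl l2) //; last by rewrite addrK.
  by rewrite -normrN; congr (`| _ |); rewrite /=; ring.
Qed.

(** * Leaves *)

(** The projection of the horizontal line through [z], without its cone
point if there is one: that line is then folded at the cone point, and the
leaf is the separatrix issuing from it. *)
Definition leaf (z : plane) : set M :=
  [set x | ~ S x /\ exists2 w : plane, w.2 = z.2 & p w = x].

Definition leaves : set (set M) := [set Lf | exists2 z, ~ P z & Lf = leaf z].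

Lemma leaf_fiber z w : p z = p w -> leaf z `<=` leaf w.
Proof.
move=> pzw x [nSx [v vz pv]]; split=> //; rewrite -pv.
case/(cover_fiber pC): pzw => h.
- exists (v + (w - z)); first by rewrite /= vz; ring.
  by symmetry; apply/(cover_fiber pC); left; rewrite addrAC subrr add0r.
- exists (w + z - v); first by rewrite /= vz; ring.
  by symmetry; apply/(cover_fiber pC); right; rewrite subrK.
Qed.

Lemma leaf_through Lf w : leaves Lf -> Lf (p w) -> Lf = leaf w.
Proof.
move=> [z nPz ->] [_ [v vz pv]].
have -> : leaf z = leaf v by rewrite /leaf vz.
by apply/seteqP; split; exact: leaf_fiber.
Qed.

Lemma leaf_no_cone Lf x : leaves Lf -> Lf x -> ~ S x.
Proof. by move=> [z _ ->] []. Qed.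

(** The lines over a leaf are the images of one line by the
countably many deck transformations. *)
Lemma leaf_heights_countable Lf : leaves Lf ->
  countable [set h | exists2 w : plane, Lf (p w) & h = w.2].
Proof.
move=> [z _ ->].
pose f (lb : plane * bool) := if lb.2 then lb.1.2 + z.2 else lb.1.2 - z.2.
have cL : countable (L `*` [set: bool]).
  by apply: countableX; [exact: lat_countable pC | exact: countableP].
have cfL : countable (f @` (L `*` [set: bool])).
  by apply: sub_countable cL; exact: card_image_le.
apply: sub_countable cfL; apply: subset_card_le => h [w [_ [v vz pvw]] ->].
case/(cover_fiber pC): pvw => Lv.
- by exists (w - v, true) => //; rewrite /f /= -vz subrK.
- by exists (w + v, false) => //; rewrite /f /= -vz addrK.
Qed.

Lemma leaves_partition : partition leaves id (~` S).
Proof.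
split.
- apply/seteqP; split=> [x [Lf FL Lx]|x nSx]; first exact: leaf_no_cone Lx.
  have [z zE] := cover_surj pC x; exists (leaf z).
    by exists z => // Pz; apply: nSx; exists z.
  by split => //; exists z.
- move=> A B FA FB [x [Ax Bx]]; have [z zE] := cover_surj pC x.
  by rewrite (leaf_through FA (w := z)) ?zE // (leaf_through FB (w := z)) ?zE.
- move=> Lf [z nPz ->]; exists (p z); split; last by exists z.
  by move/coneP.
Qed.

Definition seg (v w : plane) (t : R) : plane := v + t *: (w - v).

Lemma seg_continuous v w : continuous (seg v w).
Proof.
by move=> t; apply: cvgD; [exact: cvg_cst | apply: cvgZr_tmp; exact: cvg_id].
Qed.

Lemma seg_join (A : set M) (v w : plane) :
  (forall t : R, 0 <= t <= 1 -> A (p (seg v w t))) -> path_joined R A (p v) (p w).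
Proof.
move=> sA; exists (p \o seg v w); split.
- apply: continuous_subspaceT => t; apply: continuous_comp.
    exact: seg_continuous.
  exact: (cover_continuous pC).
- by rewrite /= /seg scale0r addr0.
- by rewrite /= /seg scale1r subrKC.
- by move=> x [t]; rewrite /= in_itv /= => tI <-; exact: sA.
Qed.

Lemma seg_height (v w : plane) t : v.2 = w.2 -> (seg v w t).2 = v.2.
Proof. by move=> vw; rewrite /seg /= vw subrr scaler0 addr0. Qed.

Lemma reflect_cover (q w : plane) : P q -> p (q + q - w) = p w.
Proof. by move=> Pq; apply/(cover_fiber pC); right; rewrite subrKC. Qed.

(** Twice the difference is a lattice vector on the horizontal
axis. *)
Lemma half_lattice_height (q q' : plane) : P q -> P q' -> q.2 = q'.2 -> q = q'.
Proof.
move=> Pq Pq' qq; have h : (q + q) - (q' + q') = 0.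
  by apply: (lat_irr2 pC); [exact: (latB pC) | rewrite /= qq subrr].
case: q q' qq h {Pq Pq'} => a b [a' b'] /= -> [h _]; congr (_, _); lra.
Qed.

(** If the segment between the lifts crosses a half-lattice point
[q], reflecting one of its ends through [q] brings both ends to the same side
of [q], and by [half_lattice_height] the new segment meets no other half-lattice
point. *)
Lemma leaf_path_connected Lf : leaves Lf -> path_connected R Lf.
Proof.
move=> [z nPz ->] x y [nSx [v vz pv]] [nSy [w wz pw]]; rewrite -pv -pw.
have nPv : ~ P v by move=> Pv; apply: nSx; exists v.
have nPw : ~ P w by move=> Pw; apply: nSy; exists w.
have join w' : w'.2 = v.2 ->
    (forall t : R, 0 <= t <= 1 -> ~ P (seg v w' t)) ->
    path_joined R (leaf z) (p v) (p w').
  move=> w'z nP; apply: seg_join => t tI; split; first by move/coneP; exact: nP.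
  by exists (seg v w' t) => //; rewrite seg_height.
have [[t [tI Pq]]|nex] := pselect (exists t, 0 <= t <= 1 /\ P (seg v w t)); last first.
  apply: join => [|t tI Pt]; first by rewrite wz.
  by apply: nex; exists t.
set q := seg v w t in Pq.
have q2 : q.2 = v.2 by rewrite seg_height // wz.
have w'2 : (q + q - w).2 = v.2 by rewrite -[LHS]/(q.2 + q.2 - w.2) q2 wz vz addrK.
rewrite -(reflect_cover w Pq); apply: join => // t' t'I Pq'.
have := half_lattice_height Pq Pq'; rewrite seg_height // => /(_ q2) qE.
have vw : v.1 <> w.1.
  move=> vw; apply: nPv; suff <- : q = v by [].
  rewrite (surjective_pairing q) q2 /q /seg /= vw subrr scaler0 addr0 -vw.
  by rewrite -surjective_pairing.
(* q is the point of parameter t on the segment from v to w, and the point of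
   parameter t' on the one from v to the reflection of w, which is the point
   2 t - 1 of the line; this forces t to be 0 or 1. *)
have e : t = t' * (2 * t - 1).
  have /eqP := congr1 fst qE; rewrite /q /seg /= => /eqP e.
  have : (t - t' * (2 * t - 1)) * (w.1 - v.1) = 0.
    by move: e; rewrite /GRing.scale /=; nra.
  move/eqP; rewrite mulf_eq0 => /orP[|]; rewrite subr_eq0 => /eqP //.
  by move/esym/vw.
have : t = 0 \/ t = 1.
  case/andP: tI t'I => t0 t1 /andP[t'0 t'1].
  case: (leP (2 * t) 1) => ht; [left | right]; nra.
case=> te; [apply: nPv | apply: nPw]; move: Pq; rewrite /q te /seg.
- by rewrite scale0r addr0.
- by rewrite scale1r subrKC.
Qed.

(** A path in the trace of a leaf on [U] keeps its height because
it can only take countably many; conversely points at the same height are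
required to be joined inside the leaf.  Hence on both sides of the definition
of [straightens] the component of [x] consists of the points of [U] that are at
the height of [x] and are not singular. *)
Lemma straightens_intro (U : set M) (phi : M -> plane) (h : plane -> R) :
  (forall x, U x -> {for x, continuous phi}) -> set_inj U phi -> continuous h ->
  (forall Lf, leaves Lf -> countable [set h (phi y) | y in Lf `&` U]) ->
  (forall Lf x y, leaves Lf -> Lf x -> U x -> U y -> ~ S y ->
     h (phi x) = h (phi y) -> path_joined R (Lf `&` U) x y) ->
  straightens S leaves U phi h.
Proof.
move=> cphi iphi ch cL jL Lf x FL [Lx Ux]; apply/seteqP; split=> y.
- move=> [g [cg g0 g1 gA]].
  have gU t : 0 <= t <= 1 -> (Lf `&` U) (g t).
    by move=> tI; apply: gA; exists t => //=; rewrite in_itv.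
  have Uy : U y by rewrite -g1; have [] := gU 1 ltac:(by rewrite lexx ler01).
  split=> //=; exists (phi \o g).
  have cphig : {within `[0, 1], continuous (phi \o g)}.
    apply: within_continuous_comp => //= z; rewrite inE => -[t /=].
    by rewrite in_itv /= => /gU[_ Ugt] <-; exact: cphi.
  split; rewrite /= ?g0 ?g1 // => z [t]; rewrite /= in_itv /= => tI <-.
  have [Lgt Ugt] := gU t tI.
  split; first by exists (g t) => //; split=> //; exact: leaf_no_cone Lgt.
  case/andP: tI => t0 t1; rewrite /= -[in RHS]g0; symmetry.
  apply: (countable_range_const t0 (cL _ FL) (k := h \o (phi \o g))).
    have sub : `[0, t] `<=` `[0, 1].
      by move=> s /=; rewrite !in_itv /= => /andP[-> /le_trans->].
    apply: (continuous_subspaceW sub).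
    by apply: within_continuous_comp => //= z' _; exact: ch.
  move=> s /andP[s0 st]; exists (g s) => //; apply: gU.
  by rewrite s0 (le_trans st).
- move=> [Uy [g [_ g0 g1 gA]]].
  have [[y' [Uy' nSy'] y'E] hy] :
      (phi @` (U `\` S) `&` [set z | h z = h (phi x)]) (phi y).
    by rewrite -g1; apply: gA; exists 1 => //=; rewrite in_itv /= lexx ler01.
  have yy : y' = y by apply: iphi; rewrite ?inE.
  by apply: jL => //; rewrite -yy.
Qed.

Lemma dball_seg (z v w : plane) (r t : R) : dball z r v -> dball z r w ->
  0 <= t <= 1 -> dball z r (seg v w t).
Proof.
rewrite /dball /seg /= => vz wz /andP[t0 t1].
have -> : v + t *: (w - v) - z = (1 - t) *: (v - z) + t *: (w - z).
  rewrite scalerBl scale1r [RHS]addrAC -[RHS]addrA -scalerBr opprB [w - z + _]addrA.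
  by rewrite subrK addrAC.
apply: le_lt_trans (ler_normD _ _) _; rewrite !normrZ.
rewrite !ger0_norm ?subr_ge0 //.
move: `|v - z| `|w - z| vz wz => a b ar br.
by case: (leP a b) => ab; nra.
Qed.

(** The chart [phi] and the function [h] only enter through the
composite [h \o phi], so that the same lemma serves the second coordinate of a
chart and, after the exchange of the coordinates of the plane, the first one. *)
Lemma regular_straightens z r (phi : M -> plane) (h : plane -> R) :
  away r z ->
  (forall x, (p @` dball z r) x -> {for x, continuous phi}) ->
  set_inj (p @` dball z r) phi -> continuous h ->
  (forall w, dball z r w -> h (phi (p w)) = w.2) ->
  straightens S leaves (p @` dball z r) phi h.
Proof.
move=> az cphi iphi ch hE; apply: straightens_intro => //.
- move=> Lf FL; apply: sub_countable (leaf_heights_countable FL).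
  apply: subset_card_le => _ [x [Lw [w wz xE]] <-]; subst x; exists w => //.
  exact: hE.
- move=> Lf x y FL Lv [v vz xE] [w wz yE] _; subst x y; rewrite !hE // => vw.
  rewrite (leaf_through FL Lv); apply: seg_join => t tI.
  have sB := dball_seg vz wz tI.
  split; last by exists (seg v w t).
  split; last by exists (seg v w t) => //; rewrite seg_height.
  by move/coneP; case: az => _ _; apply.
Qed.

(** The function [2 * (w.2 - q.2) ^+ 2] is the expression upstairs
of the one-prong level function.  Its level sets in the ball are pairs of
opposite segments with the same projection, except for the diameter through
[q], whose two halves have the same projection; reflecting one point through
[q] if necessary puts both points on a segment that avoids [q]. *)
Lemma prong_straightens q r (phi : M -> plane) (h : plane -> R) :
  P q -> r + r <= c ->
  (forall x, (p @` dball q r) x -> {for x, continuous phi}) ->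
  set_inj (p @` dball q r) phi -> continuous h ->
  (forall w, dball q r w -> h (phi (p w)) = 2 * (w.2 - q.2) ^+ 2) ->
  straightens S leaves (p @` dball q r) phi h.
Proof.
move=> Pq rc cphi iphi ch hE; apply: straightens_intro => //.
- move=> Lf FL; have cH := leaf_heights_countable FL.
  apply: (@sub_countable _ _ _ ((fun x => 2 * (x - q.2) ^+ 2) @`
     [set h | exists2 w : plane, Lf (p w) & h = w.2])).
    apply: subset_card_le => _ [x [Lw [w wz xE]] <-]; subst x; exists w.2; first by exists w.
    by rewrite hE.
  by apply: sub_countable cH; exact: card_image_le.
- move=> Lf x y FL Lv [v vq xE] [w wq yE] nSw; subst x y; rewrite !hE // => vw.
  rewrite (leaf_through FL Lv).
  have nSv : ~ S (p v) := leaf_no_cone FL Lv.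
  have uniq_q u : dball q r u -> P u -> u = q.
    by rewrite /dball /= => uq Pu; apply: half_lattice_gap => //; lra.
  have refl_q u : dball q r u -> dball q r (q + q - u).
    by rewrite /dball /=; rewrite addrAC addrK distrC.
  have nvq : v <> q by move=> vq'; apply: nSv; rewrite vq'; exists q.
  have nwq : w <> q by move=> wq'; apply: nSw; rewrite wq'; exists q.
  have [w' [w'q pw' w'2 w'1]] : exists w' : plane, [/\ dball q r w', p w' = p w,
      w'.2 = v.2 & v.2 = q.2 -> 0 < (v.1 - q.1) * (w'.1 - q.1)].
    have sq : (v.2 - q.2) ^+ 2 = (w.2 - q.2) ^+ 2 by lra.
    have [vq2|vq2] := pselect (v.2 = q.2).
      have wq2 : w.2 = q.2.
        by apply/eqP; rewrite -subr_eq0 -sqrf_eq0 -sq vq2 subrr expr0n.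
      have nv1 : v.1 - q.1 != 0.
        rewrite subr_eq0; apply/eqP => e; apply: nvq.
        by rewrite (surjective_pairing v) e vq2 -surjective_pairing.
      have nw1 : w.1 - q.1 != 0.
        rewrite subr_eq0; apply/eqP => e; apply: nwq.
        by rewrite (surjective_pairing w) e wq2 -surjective_pairing.
      have : (v.1 - q.1) * (w.1 - q.1) != 0 by rewrite mulf_neq0.
      rewrite neq_lt => /orP[neg|pos].
        exists (q + q - w); split; [exact: refl_q | exact: reflect_cover | | ].
          by rewrite /= wq2 vq2 addrK.
        by move=> _ /=; nra.
      by exists w; split=> //; rewrite wq2 vq2.
    move: sq => /eqP; rewrite eqf_sqr => /orP[] /eqP e.
      by exists w; split=> //; lra.
    exists (q + q - w); split; [exact: refl_q | exact: reflect_cover | | by []].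
    by rewrite /=; lra.
  rewrite -pw'; apply: seg_join => t tI; have sB := dball_seg vq w'q tI.
  split; last by exists (seg v w' t).
  split; last by exists (seg v w' t) => //; rewrite seg_height.
  move/coneP => /(uniq_q _ sB) sq.
  have sq2 : v.2 = q.2 by rewrite -sq seg_height.
  have := w'1 sq2; rewrite -sq /seg /= /GRing.scale /= => pos.
  case/andP: tI => t0 t1.
  have : (v.1 - (v.1 + t * (w'.1 - v.1))) * (w'.1 - (v.1 + t * (w'.1 - v.1))) =
     - (t * (1 - t) * (w'.1 - v.1) ^+ 2) by ring.
  have : 0 <= t * (1 - t) * (w'.1 - v.1) ^+ 2.
    by rewrite mulr_ge0 ?sqr_ge0 // mulr_ge0 // subr_ge0.
  by lra.
Qed.

(** * Regular and pronged charts *)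

(** An inverse of [p] with values in a given ball: the chart at a
regular point. *)
Definition branch (z : plane) (r : R) (x : M) : plane :=
  xget z [set w | dball z r w /\ p w = x].

Lemma branchP z r x : (p @` dball z r) x ->
  dball z r (branch z r x) /\ p (branch z r x) = x.
Proof.
by move=> [w wz pw]; rewrite /branch; case: xgetP => [v _ //|/(_ w) h]; case: h.
Qed.

Lemma branchK r z w : away r z -> dball z r w -> branch z r (p w) = w.
Proof.
move=> az wz; have [bz pb] : _ /\ _ := branchP (imageP p wz).
exact: away_inj az bz wz pb.
Qed.

Lemma cover_dball_open z r : open (p @` dball z r).
Proof. by apply: (cover_open pC); exact: open_dball. Qed.

Lemma dball_nbhs z r w : dball z r w -> nbhs w (dball z r).
Proof. by move=> wz; apply: open_nbhs_nbhs; split=> //; exact: open_dball. Qed.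

(** Charts are obtained by descending a continuous open map [f] of
the plane that is constant exactly on the traces of the fibers on a ball. *)
Lemma cover_chart z r (phi : M -> plane) (f : plane -> plane) :
  (forall w, dball z r w -> phi (p w) = f w) -> continuous f ->
  (forall v w, dball z r v -> dball z r w -> f v = f w -> p v = p w) ->
  (forall V, open V -> V `<=` dball z r -> open (f @` V)) ->
  chart (p @` dball z r) phi.
Proof.
move=> fE cf injf of_; split.
- exact: cover_dball_open.
- move=> x y /set_mem[v vz xE] /set_mem[w wz yE]; subst x y.
  by rewrite !fE //; exact: injf.
- move=> x [w wz xE]; subst x; apply: cover_descends => W /=.
  rewrite fE // => /(cf w) nW.
  suff : nbhs w [set v | W (phi (p v))] by [].
  have nW' : nbhs w [set v | W (f v)] by [].
  by near=> v; rewrite /= fE; [near: v | near: v; exact: dball_nbhs].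
- move=> V oV VU.
  have -> : phi @` V = f @` (dball z r `&` p @^-1` V).
    apply/seteqP; split=> [_ [x Vx <-]|_ [w [wz Vw] <-]].
      by have [w wz pw] := VU _ Vx; exists w; rewrite /= -?pw ?fE // pw.
    by exists (p w); rewrite ?fE.
  apply: of_; last by move=> ? [].
  apply: openI; first exact: open_dball.
  by apply: open_comp => // w _; exact: (cover_continuous pC).
Unshelve. all: by end_near. Qed.

Lemma branch_chart z r : away r z -> chart (p @` dball z r) (branch z r).
Proof.
move=> az; apply: (@cover_chart z r _ id).
- by move=> w; exact: branchK.
- by move=> w; exact: cvg_id.
- by move=> v w _ _ ->.
- by move=> V oV _; rewrite image_id.
Qed.

Lemma snd_plane_continuous : continuous (snd : plane -> R).
Proof. by move=> z; exact: cvg_snd. Qed.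

Lemma branch_regular_chart z r : away r z ->
  regular_chart S leaves (p @` dball z r) (branch z r).
Proof.
move=> az; have ch := branch_chart az; split => //.
  rewrite -subset0 => x [[w wz xE]]; subst x => /coneP Pw.
  by case: az => _ _ /(_ w wz).
have [_ inj cont _] := ch; apply: regular_straightens => //.
  exact: snd_plane_continuous.
by move=> w wz; rewrite branchK.
Qed.

(** Complex squaring, which identifies [z] and [- z]: it is the chart of
the quotient of a disc by its central symmetry. *)
Definition square (z : plane) : plane := (z.1 ^+ 2 - z.2 ^+ 2, 2 * (z.1 * z.2)).

Lemma squareN z : square (- z) = square z.
Proof. by rewrite /square /= !sqrrN mulrNN. Qed.

Lemma square_continuous : continuous square.
Proof.
move=> z; have c1 : (fst : plane -> R) @ z --> z.1 by exact: cvg_fst.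
have c2 : (snd : plane -> R) @ z --> z.2 by exact: cvg_snd.
have h1 : (fun w : plane => w.1 ^+ 2 - w.2 ^+ 2) @ z --> z.1 ^+ 2 - z.2 ^+ 2.
  by apply: cvgB; rewrite expr2; apply: cvgM.
have h2 : (fun w : plane => 2 * (w.1 * w.2)) @ z --> 2 * (z.1 * z.2).
  by apply: cvgM; [exact: cvg_cst | exact: cvgM].
exact: (pair_continuous h1 h2).
Qed.

Definition normsq (z : plane) : R := z.1 ^+ 2 + z.2 ^+ 2.

Lemma normsq_ge0 z : 0 <= normsq z.
Proof. by rewrite addr_ge0 ?sqr_ge0. Qed.

(** The identity [|z^2 - w^2| = |z - w| |z + w|] for complex
numbers, squared.  It gives the fibers of [square] as well as its openness. *)
Lemma normsq_square z w :
  normsq (square z - square w) = normsq (z - w) * normsq (z + w).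
Proof. by case: z w => [a b] [a' b']; rewrite /normsq /square /=; ring. Qed.

Lemma normsq_eq0 z : normsq z = 0 -> z = 0.
Proof.
case: z => a b; rewrite /normsq /= => /eqP.
by rewrite paddr_eq0 ?sqr_ge0 // !sqrf_eq0 => /andP[/eqP -> /eqP ->].
Qed.

Lemma square_inj z w : square z = square w -> z = w \/ z = - w.
Proof.
move=> e; have : normsq (z - w) * normsq (z + w) = 0.
  by rewrite -normsq_square e subrr /normsq /= expr0n addr0.
move/eqP; rewrite mulf_eq0 => /orP[] /eqP /normsq_eq0 /eqP.
- by rewrite subr_eq0 => /eqP; left.
- by rewrite addr_eq0 => /eqP; right.
Qed.

Lemma square_surj w : exists z, square z = w.
Proof.
set n := Num.sqrt (normsq w).
have n2 : n ^+ 2 = w.1 ^+ 2 + w.2 ^+ 2 by rewrite sqr_sqrtr ?normsq_ge0.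
have nw : `|w.1| <= n.
  by rewrite -sqrtr_sqr ler_wsqrtr // /normsq lerDl sqr_ge0.
move: nw; rewrite ler_norml => /andP[n1 n1'].
have e1 : 0 <= (n + w.1) / 2 by rewrite divr_ge0 //; lra.
have e2 : 0 <= (n - w.1) / 2 by rewrite divr_ge0 //; lra.
have e3 : Num.sqrt ((n + w.1) / 2) * Num.sqrt ((n - w.1) / 2) = `|w.2| / 2.
  rewrite -sqrtrM // -[RHS]ger0_norm ?divr_ge0 // -sqrtr_sqr; congr Num.sqrt.
  rewrite exprMn -normrX ger0_norm ?sqr_ge0 //.
  by transitivity ((n ^+ 2 - w.1 ^+ 2) / 4); [field | rewrite n2; field].
exists (Num.sqrt ((n + w.1) / 2),
        (if w.2 < 0 then -1 else 1) * Num.sqrt ((n - w.1) / 2)).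
rewrite /square /= [RHS]surjective_pairing; congr (_, _).
  rewrite exprMn !sqr_sqrtr //.
  by case: ifP => _; rewrite ?sqrrN expr1n; lra.
rewrite [X in 2 * X]mulrCA e3; case: ltP => h; last by rewrite ger0_norm //; field.
by rewrite ltr0_norm //; field.
Qed.

Lemma norm_normsq (z : plane) e : 0 < e -> normsq z < e ^+ 2 -> `|z| < e.
Proof.
move=> e0 ze; rewrite prod_normE gt_max.
have h (x y : R) : x ^+ 2 + y ^+ 2 < e ^+ 2 -> `|x| < e.
  move=> xy; rewrite -(ltr_pXn2r (n := 2)) ?nnegrE ?(ltW e0) //.
  by rewrite real_normK ?num_real //; have := sqr_ge0 y; lra.
apply/andP; split; first exact: h ze.
by apply: (h _ z.1); rewrite addrC.
Qed.

(** If [v ^ 2] is close to [z ^ 2] then [v - z] or [v + z] is small by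
[normsq_square], so [v] or [- v] is a square root close to [z]. *)
Lemma square_open V : open V -> open (square @` V).
Proof.
move=> oV; rewrite openE => _ [z Vz <-]; rewrite /interior.
have : nbhs z V by exact: open_nbhs_nbhs.
move/nbhs_plane => [e e0 eV]; apply/nbhs_plane; exists (e ^+ 2 / 2).
  by rewrite divr_gt0 ?exprn_gt0.
move=> w wz; have [v vE] := square_surj w.
have small : normsq (v - z) * normsq (v + z) < e ^+ 2 * e ^+ 2.
  rewrite -normsq_square vE; move: wz; rewrite prod_normE gt_max => /andP[].
  rewrite /normsq !ltr_norml => /andP[a1 a2] /andP[b1 b2].
  set a := (w - square z).1 in a1 a2 *; set b := (w - square z).2 in b1 b2 *.
  have : a ^+ 2 <= (e ^+ 2 / 2) ^+ 2 by nra.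
  have : b ^+ 2 <= (e ^+ 2 / 2) ^+ 2 by nra.
  have : 0 < e ^+ 2 * e ^+ 2 by rewrite mulr_gt0 ?exprn_gt0.
  by nra.
have [h|h] := ltP (normsq (v - z)) (e ^+ 2).
  by exists v => //; apply: eV; exact: norm_normsq.
have [h'|h'] := ltP (normsq (v + z)) (e ^+ 2).
  exists (- v); last by rewrite squareN.
  by apply: eV; rewrite -opprD normrN; exact: norm_normsq.
exfalso; move: small; rewrite ltNge => /negP; apply.
by apply: ler_pM => //; exact: sqr_ge0.
Qed.

(** The level sets of the one-prong function pull back by squaring to
pairs of opposite horizontal lines; this is why the cone points are
one-pronged. *)
Lemma prong_hE z : prong_h 1 (square z) = 2 * z.2 ^+ 2.
Proof.
rewrite /prong_h !expr1 /= -[X in X - _]/(Num.sqrt (normsq (square z))).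
have -> : normsq (square z) = normsq z ^+ 2 by rewrite /normsq /square /=; ring.
by rewrite sqrtr_sqr ger0_norm ?normsq_ge0 // /normsq; ring.
Qed.

Lemma prong_vE z : prong_v 1 (square z) = 2 * z.1 ^+ 2.
Proof.
rewrite /prong_v !expr1 /= -[X in X + _]/(Num.sqrt (normsq (square z))).
have -> : normsq (square z) = normsq z ^+ 2 by rewrite /normsq /square /=; ring.
by rewrite sqrtr_sqr ger0_norm ?normsq_ge0 // /normsq; ring.
Qed.

Lemma modulus_continuous :
  continuous (fun z : plane => Num.sqrt (z.1 ^+ 2 + z.2 ^+ 2) : R).
Proof.
move=> z; apply: (@continuous_comp _ _ _ (fun z : plane => z.1 ^+ 2 + z.2 ^+ 2));
  last exact: sqrt_continuous.
have c1 : (fst : plane -> R) @ z --> z.1 by exact: cvg_fst.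
have c2 : (snd : plane -> R) @ z --> z.2 by exact: cvg_snd.
by apply: cvgD; rewrite expr2; apply: cvgM.
Qed.

Lemma prong_h_continuous : continuous (prong_h 1 : plane -> R).
Proof.
move=> z; rewrite (_ : prong_h 1 = fun z : plane =>
    Num.sqrt (z.1 ^+ 2 + z.2 ^+ 2) - z.1 : R); last first.
  by apply/funext => v; rewrite /prong_h !expr1.
by apply: cvgB; [exact: modulus_continuous | exact: cvg_fst].
Qed.

Lemma prong_v_continuous : continuous (prong_v 1 : plane -> R).
Proof.
move=> z; rewrite (_ : prong_v 1 = fun z : plane =>
    Num.sqrt (z.1 ^+ 2 + z.2 ^+ 2) + z.1 : R); last first.
  by apply/funext => v; rewrite /prong_v !expr1.
by apply: cvgD; [exact: modulus_continuous | exact: cvg_fst].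
Qed.

(** The chart at the cone point [p q].  The lift is only defined up to
the reflection through [q], which disappears after squaring. *)
Definition folded_branch (q : plane) (r : R) (x : M) : plane :=
  square (branch q r x - q).

Lemma folded_branchE q r w : P q -> r + r <= c -> dball q r w ->
  folded_branch q r (p w) = square (w - q).
Proof.
move=> Pq rc wq; have [bq pb] : _ /\ _ := branchP (imageP p wq).
rewrite /folded_branch; set b := branch q r (p w) in bq pb *.
case/(cover_fiber pC): pb => h.
- suff -> : b = w by [].
  apply/esym/eqP; rewrite -subr_eq0; apply/eqP; apply: (lat_gap pC) => //.
  by have := ler_distD q w b; move: bq wq; rewrite /dball /= (distrC q b); lra.
- suff -> : b - q = - (w - q) by rewrite squareN.
  apply/eqP; rewrite -addr_eq0; apply/eqP; apply: (lat_gap pC).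
    by rewrite addrACA -opprD [b + w]addrC; apply: (latB pC).
  by have := ler_normD (b - q) (w - q); move: bq wq; rewrite /dball /=; lra.
Qed.

Lemma folded_chart q r : P q -> r + r <= c ->
  chart (p @` dball q r) (folded_branch q r).
Proof.
move=> Pq rc; apply: (@cover_chart q r _ (fun w => square (w - q))).
- by move=> w; exact: folded_branchE.
- move=> w; apply: (@continuous_comp _ _ _ (fun w : plane => w - q) square).
    by apply: cvgB; [exact: cvg_id | exact: cvg_cst].
  exact: square_continuous.
- move=> v w vq wq /square_inj[/addIr -> //|e].
  rewrite -(reflect_cover v Pq); congr p.
  by rewrite -addrA -[q - v]opprB e opprK addrC subrK.
- move=> V oV _.
  have -> : (fun w => square (w - q)) @` V = square @` ((fun w => w + q) @^-1` V).
    apply/seteqP; split=> [_ [w Vw <-]|_ [w Vw <-]].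
      by exists (w - q) => //=; rewrite subrK.
    by exists (w + q) => //; rewrite addrK.
  apply: square_open; apply: open_comp => // w _.
  by apply: cvgD; [exact: cvg_id | exact: cvg_cst].
Qed.

Lemma folded_prong_chart q r : P q -> 0 < r -> r + r <= c ->
  prong_chart S leaves 1 (p q) (p @` dball q r) (folded_branch q r).
Proof.
move=> Pq r0 rc; have ch := folded_chart Pq rc.
have qq : dball q r q by rewrite /dball /= subrr normr0.
split=> //.
- apply/seteqP; split=> [x [[w wq xE]]|x ->].
    subst x => /coneP Pw; congr p; apply: half_lattice_gap => //.
    by move: wq; rewrite /dball /=; lra.
  by split; exists q.
- rewrite folded_branchE // subrr /square /=.
  by rewrite expr0n /= subr0 mulr0 mulr0.
- have [_ inj cont _] := ch; apply: prong_straightens => //.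
    exact: prong_h_continuous.
  by move=> w wq; rewrite folded_branchE // prong_hE.
Qed.

Lemma leaves_singular_foliation : @singular_foliation R M S leaves.
Proof.
split.
- exact: leaves_partition.
- exact: leaf_path_connected.
- move=> x nSx; have [z zE] := cover_surj pC x; subst x.
  have [r az] := away_exists (fun Pz => nSx (iffRL (coneP z) Pz)).
  have r0 : 0 < r by case: az.
  exists (p @` dball z r), (branch z r); split; last exact: branch_regular_chart.
  by exists z => //; rewrite /dball /= subrr normr0.
- move=> _ [q Pq <-]; have c0 := lat_gap_gt0 pC.
  exists 1%N, (p @` dball q (c / 2)), (folded_branch q (c / 2)); split=> //.
  by apply: folded_prong_chart => //; lra.
Qed.

(** * The transverse measure *)

Lemma transverse_arc_no_cone (alpha : R -> M) : transverse_arc S leaves alpha ->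
  forall t : R, 0 <= t <= 1 -> ~ S (alpha t).
Proof.
move=> [_ aT] t tI St.
have [|U [phi [V [[_ US0 _] Ut _ _]]]] := aT t; first by rewrite /= in_itv.
by have : (U `&` S) (alpha t) by []; rewrite US0.
Qed.

Lemma within_path_lifting (alpha : R -> M) :
  {within `[0, 1], continuous alpha} ->
  (forall t : R, 0 <= t <= 1 -> ~ S (alpha t)) -> exists g, lifts_path g alpha.
Proof.
move=> ca aS; have [|g [cg gl]] := path_lifting (clamp_extension (@ler01 R) ca).
  by move=> t tI; apply: aS; exact: clamp_in.
by exists g; split=> // t tI; rewrite gl //= clamp_id.
Qed.

(** Transversality refers to an arbitrary chart.  If two
nearby points of the arc had lifts at the same height, the segment between the
lifts would project to a path of the leaf inside the domain [U] of the chart;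
the two points would lie on one plaque, hence at the same second coordinate in
the chart.  So the height is locally injective along the lift, and
[locally_inj_inj] applies. *)
Lemma transverse_height_inj (alpha : R -> M) (g : R -> plane) :
  transverse_arc S leaves alpha -> lifts_path g alpha ->
  {in `[0, 1] &, injective (fun t => (g t).2)}.
Proof.
move=> aT [cg gl]; have aS := transverse_arc_no_cone aT.
apply: locally_inj_inj.
  apply: continuous_subspaceT => t; apply: continuous_comp; first exact: cg.
  exact: snd_plane_continuous.
move=> t tI; have [|U [phi [V [[[oU iU cU _] US0 st] Ut Vt iV]]]] := aT.2 t.
  by rewrite /= in_itv.
have nU : nbhs (g t) (p @^-1` U).
  apply: (cover_continuous pC); rewrite gl //; exact: open_nbhs_nbhs.
have [e e0 eU] := iffLR (nbhs_plane _ _) nU.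
have nB : nbhs t (g @^-1` dball (g t) e).
  by apply: cg; apply/nbhs_plane; exists e.
exists (V `&` g @^-1` dball (g t) e); first exact: filterI.
move=> s s'; rewrite !inE => -[[Vs gs] sI] [[Vs' gs'] s'I] ss'.
move: (sI) (s'I); rewrite /= !in_itv /= => sI' s'I'.
apply: iV; rewrite ?inE //=.
have FL : leaves (leaf (g s)).
  by exists (g s) => // Pgs; apply: (aS s) => //; rewrite -gl //; exists (g s).
have Us u : dball (g t) e u -> U (p u) by move=> ue; exact: eU.
have Lx : (leaf (g s) `&` U) (alpha s).
  split; last by rewrite -gl //; exact: Us.
  by split; [exact: aS | exists (g s) => //; exact: gl].
have : path_component R (leaf (g s) `&` U) (alpha s) (alpha s').
  rewrite /path_component /= -(gl s) // -(gl s') //; apply: seg_join => v vI.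
  have Uv : U (p (seg (g s) (g s') v)) by apply: Us; exact: dball_seg.
  split=> //; split; last by exists (seg (g s) (g s') v) => //; rewrite seg_height.
  by move=> Sv; have : (U `&` S) (p (seg (g s) (g s') v)) by []; rewrite US0.
rewrite (st _ _ FL Lx) => -[_ [k [_ _ k1 kA]]].
have [_] : (phi @` (U `\` S) `&` [set z | z.2 = (phi (alpha s)).2]) (phi (alpha s')).
  by rewrite -k1; apply: kA; exists 1 => //=; rewrite in_itv /= lexx ler01.
by move=> ->.
Qed.

Lemma lifts_subarc (g : R -> plane) (alpha : R -> M) a b :
  0 <= a -> a <= b -> b <= 1 -> lifts_path g alpha ->
  lifts_path (fun t => g (a + (b - a) * t)) (subarc alpha a b).
Proof.
move=> a0 ab b1 [cg gl]; split.
  move=> t; apply: (@continuous_comp _ _ _ (fun t => a + (b - a) * t) g); last exact: cg.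
  apply: cvgD; first exact: cvg_cst.
  by apply: cvgM; [exact: cvg_cst | exact: cvg_id].
by move=> t /andP[t0 t1]; rewrite gl //; apply/andP; split; nra.
Qed.

(** The height is strictly monotone along a transverse
arc. *)
Lemma lifted_height_additive (alpha : R -> M) (d : R) :
  transverse_arc S leaves alpha -> 0 < d -> d < 1 ->
  lifted_height alpha =
    lifted_height (subarc alpha 0 d) + lifted_height (subarc alpha d 1).
Proof.
move=> aT d0 d1; have aS := transverse_arc_no_cone aT.
have [g gl] := within_path_lifting aT.1 aS.
have inj := transverse_height_inj aT gl.
rewrite (lifted_heightE gl aS).
rewrite (lifted_heightE (lifts_subarc (lexx 0) (ltW d0) (ltW d1) gl)); last first.
  by move=> t /andP[t0 t1]; apply: aS; apply/andP; split; nra.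
rewrite (lifted_heightE (lifts_subarc (ltW d0) (ltW d1) (lexx 1) gl)); last first.
  by move=> t /andP[t0 t1]; apply: aS; apply/andP; split; nra.
rewrite !mulr0 !mulr1 !addr0 !subrKC.
have c1 : {within `[0, 1], continuous (fun t => (g t).2)}.
  apply: continuous_subspaceT => t; apply: continuous_comp; first exact: gl.1.
  exact: snd_plane_continuous.
have i0 : (0 : R) \in `[0, 1] by rewrite in_itv /= lexx ler01.
have i1 : (1 : R) \in `[0, 1] by rewrite in_itv /= lexx ler01.
have id_ : d \in `[0, 1] by rewrite in_itv /= !ltW.
case: (itv_continuous_inj_mono c1 inj) => mono.
- have := mono _ _ i0 id_ d0; have := mono _ _ id_ i1 d1 => /= h1 h2.
  by rewrite !gtr0_norm ?subr_gt0 //; [ring | exact: lt_trans h1].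
- have := mono _ _ id_ i0 d0; have := mono _ _ i1 id_ d1 => /= h1 h2.
  by rewrite !ltr0_norm ?subr_lt0 //; [ring | exact: lt_trans h2].
Qed.

Lemma lifted_height_gt0 (alpha : R -> M) :
  transverse_arc S leaves alpha -> 0 < lifted_height alpha.
Proof.
move=> aT; have aS := transverse_arc_no_cone aT.
have [g gl] := within_path_lifting aT.1 aS.
rewrite (lifted_heightE gl aS) normr_gt0 subr_eq0; apply/eqP => e.
have := transverse_height_inj aT gl _ _ e.
rewrite !in_itv /= !lexx !ler01 => /(_ isT isT) /eqP.
by rewrite oner_eq0.
Qed.

(** Compactness of [[0, 1]], in the form of near coverings. *)
Lemma away_path (g : R -> plane) : continuous g ->
  (forall t : R, 0 <= t <= 1 -> ~ P (g t)) ->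
  exists r, forall t : R, 0 <= t <= 1 -> away r (g t).
Proof.
move=> cg nP.
pose near_cov := iffLR (compact_near_coveringP _) (@segment_compact R 0 1).
have : \forall r \near (0 : R)^'+, `[0, 1] `<=` [set t | away r (g t)].
  apply: near_cov => t; rewrite /= in_itv /= => tI.
  have [r az] := away_exists (nP t tI); have r0 : 0 < r by case: az.
  have nB : nbhs t (g @^-1` dball (g t) (r / 2)).
    by apply: cg; apply/nbhs_plane; exists (r / 2); first by rewrite divr_gt0.
  exists (g @^-1` dball (g t) (r / 2), [set e | 0 < e /\ e < r / 2]).
    split=> //=; near=> e; split; near: e; first exact: nbhs_right_gt.
    by apply: nbhs_right_lt; rewrite divr_gt0.
  move=> [s e] /= [gs [e0 er]].
  have [_ rc nPr] := away_ball az (ltW gs).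
  by split=> //; [lra | move=> v vs; apply: nPr; lra].
move=> near_r; have [r rP] := @filter_ex _ _ (at_right_proper_filter (0 : R)) _ near_r.
by exists r => t tI; apply: rP; rewrite /= in_itv.
Unshelve. all: by end_near. Qed.

Definition in_one_leaf (beta : R -> M) :=
  exists2 Lf, leaves Lf & forall t : R, 0 <= t <= 1 -> Lf (beta t).

(** The lift of a path in a leaf only takes countably many
heights. *)
Lemma leafwise_lift_height (beta : R -> M) (g : R -> plane) (a b : R) :
  a <= b -> 0 <= a -> b <= 1 -> in_one_leaf beta ->
  {within `[a, b], continuous g} ->
  (forall t, a <= t <= b -> p (g t) = beta t) -> (g a).2 = (g b).2.
Proof.
move=> ab a0 b1 [Lf FL Lb] cg gl.
apply: (countable_range_const ab (leaf_heights_countable FL) (k := snd \o g)).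
  by apply: within_continuous_comp => // z _; exact: snd_plane_continuous.
move=> t /andP[at_ tb]; exists (g t) => //; rewrite gl ?at_ //.
by apply: Lb; apply/andP; split; lra.
Qed.

(** The invariance under leafwise isotopies is propagated
along the isotopy by [segment_induction].  Near a time [t], the lift [g] of the
arc at time [t] has evenly covered balls of uniform radius around it, and by
compactness the arcs at the nearby times stay in the projections of these
balls; this gives lifts of these arcs close to [g], which depend continuously on
both variables.  Each point of the arc moves in a leaf, so its lift keeps its
height by [leafwise_lift_height]. *)
Lemma isotopy_lifted_height (H : R * R -> M) :
  continuous H ->
  (forall z : R * R, 0 <= z.1 <= 1 -> 0 <= z.2 <= 1 -> ~ S (H z)) ->
  (forall s : R, 0 <= s <= 1 -> in_one_leaf (fun t => H (s, t))) ->
  lifted_height (fun s => H (s, 0)) = lifted_height (fun s => H (s, 1)).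
Proof.
move=> cH HS HL.
have cHs t : continuous (fun s => H (s, t)).
  move=> s; apply: (@continuous_comp _ _ _ (fun s : R => (s, t)) H); last exact: cH.
  by apply: pair_continuous; [exact: cvg_id | exact: cvg_cst].
have cHt s : continuous (fun t => H (s, t)).
  move=> t; apply: (@continuous_comp _ _ _ (fun t : R => (s, t)) H); last exact: cH.
  by apply: pair_continuous; [exact: cvg_cst | exact: cvg_id].
apply: (@segment_induction _ 0 1 (fun t =>
  lifted_height (fun s => H (s, 0)) = lifted_height (fun s => H (s, t)))) => // t tI.
have St u : 0 <= u <= 1 -> forall s : R, 0 <= s <= 1 -> ~ S (H (s, u)).
  by move=> uI s sI; exact: HS.
have [g [cg gl]] := path_lifting (cHs t) (St t tI).
have gP s : 0 <= s <= 1 -> ~ P (g s).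
  by move=> sI Pg; apply: (St t tI s sI); rewrite -gl //; exists (g s).
have [r az] := away_path cg gP.
have r0 : 0 < r by have [] := az 0 ltac:(by rewrite lexx ler01).
pose near_cov := iffLR (compact_near_coveringP _) (@segment_compact R 0 1).
pose close (u s : R) := exists2 w : plane, dball (g s) (r / 2) w & p w = H (s, u).
have : \forall u \near t, `[0, 1] `<=` close u.
  apply: (near_cov R (nbhs t) close) => s; rewrite /= in_itv /= => sI.
  have nB : nbhs s (g @^-1` dball (g s) (r / 4)).
    by apply: cg; apply/nbhs_plane; exists (r / 4); first by rewrite divr_gt0.
  have r4 : 0 < r / 4 by rewrite divr_gt0.
  have nW : nbhs (H (s, t)) (p @` dball (g s) (r / 4)).
    by rewrite -gl //; apply: cover_nbhs; apply/nbhs_plane; exists (r / 4).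
  have [[A B] /= [nA nB' AB]] : nbhs (s, t) (H @^-1` (p @` dball (g s) (r / 4))).
    exact: cH nW.
  exists (A `&` g @^-1` dball (g s) (r / 4), B).
    by split=> //=; exact: filterI.
  move=> [s' u] /= [[As' gs'] Bu].
  have [w wg pw] := AB (s', u) (conj As' Bu).
  exists w => //; rewrite /dball /=.
  by have := ler_distD (g s) w (g s'); move: wg gs'; rewrite /dball /=
    (distrC (g s) (g s')); lra.
move=> /nbhs_ballP[e /= e0 eP].
exists e => // u u' uI u'I uu' ut u't ->.
pose G s v := branch (g s) (r / 2) (H (s, v)).
have GP s v : 0 <= s <= 1 -> `|v - t| < e ->
    dball (g s) (r / 2) (G s v) /\ p (G s v) = H (s, v).
  move=> sI vt; apply: branchP.
  have vB : ball t e v by rewrite /ball /= distrC.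
  have sI' : `[0, 1]%classic s by rewrite /= in_itv.
  by have [w wg pw] := eP v vB s sI'; exists w.
have ut_in v : u <= v <= u' -> `|v - t| < e.
  by move: ut u't; rewrite !ltr_norml => /andP[? ?] /andP[? ?] /andP[? ?];
     apply/andP; split; lra.
have dball_sub s : dball (g s) (r / 2) `<=` dball (g s) r.
  by move=> w; rewrite /dball /=; lra.
have liftG v : `|v - t| < e ->
    lifts_path ((fun s => G s v) \o clamp 0 1) (fun s => H (s, v)).
  move=> vt; split; last first.
    by move=> s sI; rewrite /= clamp_id // (GP s v sI vt).2.
  move=> s; set s0 := clamp 0 1 s; have s0I : 0 <= s0 <= 1 by exact: clamp_in.
  have cK : {for s, continuous ((fun s => H (s, v)) \o clamp 0 1)}.
    by apply: continuous_comp; [exact: clamp_continuous | exact: cHs].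
  have [G1 G2] := GP s0 v s0I vt.
  apply: (nearby_lift_continuous (az s0 s0I) cK) => //; first exact: dball_sub.
  have nB : nbhs s ((g \o clamp 0 1) @^-1` dball (g s0) (r / 2)).
    apply: (@continuous_comp _ _ _ (clamp 0 1) g); first exact: clamp_continuous.
      exact: cg.
    by apply/nbhs_plane; exists (r / 2); first by rewrite divr_gt0.
  near=> s'.
  have s'I : 0 <= clamp 0 1 s' <= 1 by exact: clamp_in.
  have [G1' G2'] := GP _ v s'I vt; split=> //=.
  have : dball (g s0) (r / 2) (g (clamp 0 1 s')) by near: s'.
  have := ler_distD (g (clamp 0 1 s')) (G (clamp 0 1 s') v) (g s0).
  by move: G1'; rewrite /dball /=; lra.
have heightG s : 0 <= s <= 1 -> (G s u).2 = (G s u').2.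
  move=> sI; have -> : u = clamp u u' u by rewrite clamp_id // lexx uu'.
  have {2}-> : u' = clamp u u' u' by rewrite clamp_id // lexx uu'.
  case/andP: uI => u0 u1; case/andP: u'I => u'0 u'1.
  apply: (leafwise_lift_height uu' u0 u'1 (HL s sI)
    (g := (fun v => G s v) \o clamp u u')); last first.
    by move=> v vI; rewrite /= clamp_id //; exact: (GP s v sI (ut_in v vI)).2.
  apply: continuous_subspaceT => v.
  have cK : {for v, continuous ((fun v => H (s, v)) \o clamp u u')}.
    by apply: continuous_comp; [exact: clamp_continuous | exact: cHt].
  have vt v' : `|clamp u u' v' - t| < e by apply: ut_in; exact: clamp_in.
  have [G1 G2] := GP s _ sI (vt v).
  apply: (nearby_lift_continuous (az s sI) cK) => //; first exact: dball_sub.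
  near=> v'; have [G1' G2'] := GP s _ sI (vt v'); split=> //; exact: dball_sub.
have uu : u <= u <= u' by rewrite lexx.
have u'u : u <= u' <= u' by rewrite lexx andbT.
rewrite (lifted_heightE (liftG u (ut_in u uu)) (St u uI)).
rewrite (lifted_heightE (liftG u' (ut_in u' u'u)) (St u' u'I)).
by rewrite /= !clamp_id ?lexx ?ler01 // !heightG // ?lexx ?ler01.
Unshelve. all: by end_near. Qed.

(** The isotopy is extended to the plane by clamping before
[isotopy_lifted_height] is applied.  In the last clause the inverse branch of
[p] provides the lift. *)
Lemma lifted_height_measure : transverse_measure S leaves lifted_height.
Proof.
split.
- exact: lifted_height_gt0.
- exact: lifted_height_additive.
- move=> H cH HT HL.
  have cc : continuous (fun z : R * R => (clamp 0 1 z.1, clamp 0 1 z.2)).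
    move=> z.
    have c1 : {for z, continuous (fun w : R * R => clamp 0 1 w.1)}.
      apply: (@continuous_comp _ _ _ (fst : R * R -> R)); first exact: cvg_fst.
      exact: clamp_continuous.
    have c2 : {for z, continuous (fun w : R * R => clamp 0 1 w.2)}.
      apply: (@continuous_comp _ _ _ (snd : R * R -> R)); first exact: cvg_snd.
      exact: clamp_continuous.
    exact: (pair_continuous c1 c2).
  pose H' := H \o (fun z : R * R => (clamp 0 1 z.1, clamp 0 1 z.2)).
  have c01 (t : R) : 0 <= clamp 0 1 t <= 1 by exact: clamp_in.
  have cH' : continuous H'.
    move=> z W nW.
    set z' := (clamp 0 1 z.1, clamp 0 1 z.2).
    have z'I : (`[0, 1] `*` `[0, 1])%classic z'.
      by split; rewrite /= in_itv /=; exact: c01.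
    have h1 := cH z' W nW.
    have h2 : within (`[0, 1] `*` `[0, 1]) (nbhs z') (H @^-1` W).
      by rewrite (nbhs_subspace_in z'I).
    have h3 := cc z _ h2.
    suff : nbhs z [set v | W (H' v)] by [].
    have h4 : nbhs z [set v : R * R | (`[0, 1] `*` `[0, 1])%classic
       (clamp 0 1 v.1, clamp 0 1 v.2) -> W (H' v)] by [].
    by apply: filterS h4 => v; apply; split; rewrite /= in_itv /=; exact: c01.
  have HH' (z : R * R) : 0 <= z.1 <= 1 -> 0 <= z.2 <= 1 -> H' z = H z.
    by move=> z1 z2; rewrite /H' /= !clamp_id // -surjective_pairing.
  have HS (z : R * R) : 0 <= z.1 <= 1 -> 0 <= z.2 <= 1 -> ~ S (H z).
    move=> z1 z2; have tz : `[0, 1]%classic z.2 by rewrite /= in_itv.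
    by have := transverse_arc_no_cone (HT z.2 tz) z1; rewrite -surjective_pairing.
  have ext t : 0 <= t <= 1 ->
      lifted_height (fun s => H (s, t)) = lifted_height (fun s => H' (s, t)).
    move=> tI; have cs : continuous (fun s : R => H' (s, t)).
      move=> s; apply: (@continuous_comp _ _ _ (fun s : R => (s, t)) H'); last exact: cH'.
      by apply: pair_continuous; [exact: cvg_id | exact: cvg_cst].
    have [|g gl] := path_lifting cs.
      by move=> s sI; rewrite HH' //; exact: HS.
    rewrite (lifted_heightE gl); last by move=> s sI; rewrite HH' //; exact: HS.
    rewrite (@lifted_heightE g) //; last by move=> s sI; exact: HS.
    by case: gl => cg gl; split=> // s sI; rewrite gl // HH'.
  rewrite !ext ?lexx ?ler01 //; apply: isotopy_lifted_height => //.
    by move=> z z1 z2; rewrite HH' //; exact: HS.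
  move=> s sI; have [|Lf FL LH] := HL s; first by rewrite /= in_itv.
  by exists Lf => // t tI; rewrite HH' //; apply: LH; rewrite /= in_itv.
- move=> x nSx; have [z zE] := cover_surj pC x; subst x.
  have [r az] := away_exists (fun Pz => nSx (iffRL (coneP z) Pz)).
  have r0 : 0 < r by case: az.
  exists (p @` dball z r), (branch z r); split; last first.
  + move=> alpha aT aU _.
    have aS := transverse_arc_no_cone aT.
    have [_ _ cb _] := branch_chart az.
    have aU' t : 0 <= t <= 1 -> (p @` dball z r) (alpha t).
      by move=> tI; apply: aU; exists t => //=; rewrite in_itv.
    have cba : {within `[0, 1], continuous (branch z r \o alpha)}.
      apply: within_continuous_comp; last exact: aT.1.
      move=> y; rewrite inE => -[t /=]; rewrite in_itv /= => tI <-.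
      by apply: cb; exact: aU'.
    have gl : lifts_path ((branch z r \o alpha) \o clamp 0 1) alpha.
      split; first exact: (clamp_extension (@ler01 R) cba).
      by move=> t tI; rewrite /= clamp_id //; exact: (branchP (aU' t tI)).2.
    by rewrite (lifted_heightE gl aS) /= !clamp_id ?lexx ?ler01.
  + exact: branch_regular_chart.
  + by exists z => //; rewrite /dball /= subrr normr0.
Qed.

End FlatCover.

(** * Exchanging the two foliations *)

Section Symmetry.
Context {R : realType} {M : topologicalType}.
Local Notation plane := (R * R)%type.

(** The vertical foliation of [p] is the horizontal foliation of
[p \o flip], so that one set of lemmas serves both. *)
Definition flip (z : plane) : plane := (z.2, z.1).

Lemma flipK : involutive flip.
Proof. by case. Qed.

Lemma norm_flip z : `|flip z| = `|z|.
Proof. by rewrite !prod_normE /= maxC. Qed.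

Lemma flip_continuous : continuous flip.
Proof.
move=> z; have c1 : {for z, continuous (snd : plane -> R)} by exact: cvg_snd.
have c2 : {for z, continuous (fst : plane -> R)} by exact: cvg_fst.
exact: (pair_continuous c1 c2).
Qed.

Lemma flip_image (X : Type) (p : plane -> X) (V : set plane) :
  (p \o flip) @` (flip @^-1` V) = p @` V.
Proof.
apply/seteqP; split=> [_ [z Vz <-]|_ [z Vz <-]]; first by exists (flip z).
by exists (flip z); rewrite /= flipK.
Qed.

Lemma flip_dball (X : Type) (p : plane -> X) (z : plane) (r : R) :
  (p \o flip) @` dball (flip z) r = p @` dball z r.
Proof.
rewrite -(flip_image p (dball z r)); congr (_ @` _); apply/funext => w.
by rewrite /dball /= -[in RHS]norm_flip.
Qed.

Context {L : set plane} {c : R} {p : plane -> M}.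
Hypothesis pC : flat_cover L c p.

Lemma flat_cover_flip : flat_cover (flip @^-1` L) c (p \o flip).
Proof.
split.
- exact: lat0 pC.
- by move=> v w; exact: (latB pC).
- apply: sub_countable (lat_countable pC).
  rewrite (_ : flip @^-1` L = flip @` L); first exact: card_image_le.
  apply/seteqP; split=> [z Lz|_ [z Lz <-]]; last by rewrite /= flipK.
  by exists (flip z) => //; rewrite flipK.
- exact: lat_gap_gt0 pC.
- move=> v Lv vc; rewrite -[v]flipK [flip v](lat_gap pC) // norm_flip //.
- move=> v Lv v1; rewrite -[v]flipK [flip v](lat_irr2 pC) //.
- move=> v Lv v2; rewrite -[v]flipK [flip v](lat_irr1 pC) //.
- move=> z; apply: continuous_comp; first exact: flip_continuous.
  exact: (cover_continuous pC).
- move=> x; have [z <-] := cover_surj pC x; exists (flip z).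
  by rewrite /= flipK.
- move=> V oV; rewrite -[V](_ : flip @^-1` (flip @^-1` V) = V).
    rewrite flip_image; apply: (cover_open pC).
    by apply: open_comp => // z _; exact: flip_continuous.
  by apply/seteqP; split=> z /=; rewrite flipK.
- by move=> z w; exact: (cover_fiber pC).
- rewrite (_ : half_lattice _ = flip @^-1` half_lattice L) //.
  by rewrite flip_image; exact: cone_finite pC.
Qed.

Lemma flip_cones : (p \o flip) @` half_lattice (flip @^-1` L) = p @` half_lattice L.
Proof. by rewrite -(flip_image p). Qed.

Lemma away_flip r z : away (L := L) (c := c) r z ->
  away (L := flip @^-1` L) (c := c) r (flip z).
Proof.
move=> [r0 rc h]; split=> // v vz; apply: (h (flip v)).
by rewrite -norm_flip /=; move: vz; rewrite /flip /=.
Qed.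

(** The charts of the horizontal foliation straighten the vertical
one as well: the first coordinate of a regular chart and the function
[prong_v 1] in the folded chart are, after [flip], the functions to which
[regular_straightens] and [prong_straightens] apply. *)
Lemma leaves_transverse :
  @transverse_foliations R M (p @` half_lattice L) (leaves (L := L) (p := p))
    (leaves (L := flip @^-1` L) (p := p \o flip)).
Proof.
have pC' := flat_cover_flip.
have cones := flip_cones.
split.
- move=> x nSx; have [z zE] := cover_surj pC x; subst x.
  have [r az] := away_exists pC (fun Pz => nSx (iffRL (coneP pC z) Pz)).
  have r0 : 0 < r by case: az.
  exists (p @` dball z r), (branch (p := p) z r); split.
  + by exists z => //; rewrite /dball /= subrr normr0.
  + exact: (branch_regular_chart pC).
  + have [_ inj cont _] := branch_chart pC az.
    have := @regular_straightens _ _ _ _ _ pC' (flip z) r (branch (p := p) z r) fst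
      (away_flip az).
    rewrite cones flip_dball; apply=> //.
      by move=> v; exact: cvg_fst.
    move=> w wz; rewrite /= (branchK pC) //.
    by move: wz; rewrite /dball /= -norm_flip.
- move=> _ [q Pq <-]; have c0 := lat_gap_gt0 pC.
  have c2 : 0 < c / 2 by rewrite divr_gt0.
  have rc : c / 2 + c / 2 <= c by lra.
  exists 1%N, (p @` dball q (c / 2)), (folded_branch (p := p) q (c / 2)).
  split=> //; first exact: (folded_prong_chart pC).
  have [_ inj cont _] := folded_chart pC Pq rc.
  have := @prong_straightens _ _ _ _ _ pC' (flip q) (c / 2)
     (folded_branch (p := p) q (c / 2)) (prong_v 1) Pq rc.
  rewrite cones flip_dball; apply=> //; first exact: prong_v_continuous.
  move=> w wq; rewrite /= (folded_branchE pC) ?prong_vE //.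
  by move: wq; rewrite /dball /= -norm_flip.
Qed.

End Symmetry.

(** * Homeomorphisms induced by diagonal matrices *)

Section LinearAction.
Context {R : realType} {M : topologicalType}.
Local Notation plane := (R * R)%type.

Definition diagonal (a b : R) (z : plane) : plane := (a * z.1, b * z.2).

Lemma diagonal_continuous a b : continuous (diagonal a b).
Proof.
move=> z; have c1 : {for z, continuous (fun w : plane => a * w.1)}.
  by apply: cvgM; [exact: cvg_cst | exact: cvg_fst].
have c2 : {for z, continuous (fun w : plane => b * w.2)}.
  by apply: cvgM; [exact: cvg_cst | exact: cvg_snd].
exact: (pair_continuous c1 c2).
Qed.

Lemma diagonal_comp a b a' b' z :
  diagonal a b (diagonal a' b' z) = diagonal (a * a') (b * b') z.
Proof. by rewrite /diagonal /= !mulrA. Qed.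

Lemma diagonal1 z : diagonal 1 1 z = z.
Proof. by rewrite /diagonal !mul1r -surjective_pairing. Qed.

Lemma diagonalB a b z w : diagonal a b (z - w) = diagonal a b z - diagonal a b w.
Proof. by rewrite /diagonal /= !mulrBr. Qed.

Lemma diagonalD a b z w : diagonal a b (z + w) = diagonal a b z + diagonal a b w.
Proof. by rewrite /diagonal /= !mulrDr. Qed.

Context {L : set plane} {c : R} {p : plane -> M}.
Hypothesis pC : flat_cover L c p.

Lemma diagonal_fiber a b z w : (forall v, L v -> L (diagonal a b v)) ->
  p z = p w -> p (diagonal a b z) = p (diagonal a b w).
Proof.
move=> La /(cover_fiber pC)[h|h]; apply/(cover_fiber pC); [left | right].
  by rewrite -diagonalB; exact: La.
by rewrite -diagonalD; exact: La.
Qed.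

Definition descend a b (x : M) : M :=
  p (diagonal a b (projT1 (cid (cover_surj pC x)))).

Lemma descendE a b z : (forall v, L v -> L (diagonal a b v)) ->
  descend a b (p z) = p (diagonal a b z).
Proof.
by move=> La; rewrite /descend; case: cid => w /= pw; exact: diagonal_fiber.
Qed.

Lemma descend_continuous a b : (forall v, L v -> L (diagonal a b v)) ->
  continuous (descend a b).
Proof.
move=> La x; have [z zE] := cover_surj pC x; subst x.
apply: (cover_descends pC).
rewrite (_ : descend a b \o p = p \o diagonal a b); last first.
  by apply/funext => w; exact: descendE.
apply: continuous_comp; first exact: diagonal_continuous.
exact: (cover_continuous pC).
Qed.

Lemma descend_cancel a b a' b' : a * a' = 1 -> b * b' = 1 ->
  (forall v, L v -> L (diagonal a b v)) -> (forall v, L v -> L (diagonal a' b' v)) ->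
  cancel (descend a' b') (descend a b).
Proof.
move=> aa bb La La' x; have [z zE] := cover_surj pC x; subst x.
by rewrite !descendE // diagonal_comp aa bb diagonal1.
Qed.

Variables (a b : R) (f : homeomorphism M).
Hypotheses (a0 : a != 0) (b0 : b != 0).
Hypothesis Lab : forall v, L v -> L (diagonal a b v).
Hypothesis Lba : forall v, L v -> L (diagonal a^-1 b^-1 v).
Hypothesis fE : forall z, f (p z) = p (diagonal a b z).

Lemma hinvE z : hinv f (p z) = p (diagonal a^-1 b^-1 z).
Proof.
apply: (can_inj (hfunK f)); rewrite hinvK fE diagonal_comp !mulfV //.
by rewrite diagonal1.
Qed.

Lemma half_lattice_diagonal z :
  half_lattice L (diagonal a b z) <-> half_lattice L z.
Proof.
split; rewrite /half_lattice /= => Lz; last by rewrite -diagonalD; exact: Lab.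
have zE : diagonal a^-1 b^-1 (diagonal a b z) = z.
  by rewrite diagonal_comp !mulVf // diagonal1.
by rewrite -zE -diagonalD; exact: Lba.
Qed.

(** A diagonal matrix maps horizontal lines to horizontal lines. *)
Lemma leaf_image z : f @` leaf (L := L) (p := p) z = leaf (L := L) (p := p) (diagonal a b z).
Proof.
apply/seteqP; split=> [_ [x [nSx [w wz xE]] <-]|x [nSx [w wz xE]]]; subst x.
  split; last by exists (diagonal a b w); rewrite ?fE //= wz.
  by rewrite fE => /(coneP pC) /half_lattice_diagonal /(coneP pC).
have wE : w = diagonal a b (diagonal a^-1 b^-1 w).
  by rewrite diagonal_comp !mulfV // diagonal1.
exists (p (diagonal a^-1 b^-1 w)); last by rewrite fE -wE.
split; last by exists (diagonal a^-1 b^-1 w) => //=; rewrite wz /= mulKf.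
by move/(coneP pC) => h; apply/nSx/(coneP pC); rewrite wE; apply/half_lattice_diagonal.
Qed.

Lemma leaves_image :
  [set f @` Lf | Lf in leaves (L := L) (p := p)] = leaves (L := L) (p := p).
Proof.
apply/seteqP; split=> [_ [_ [z nPz ->] <-]|_ [z nPz ->]].
  by exists (diagonal a b z); [move/half_lattice_diagonal | exact: leaf_image].
have zE : z = diagonal a b (diagonal a^-1 b^-1 z).
  by rewrite diagonal_comp !mulfV // diagonal1.
exists (leaf (L := L) (p := p) (diagonal a^-1 b^-1 z)); last by rewrite leaf_image -zE.
exists (diagonal a^-1 b^-1 z) => //.
by move/half_lattice_diagonal; rewrite -zE.
Qed.

(** The matrix multiplies heights by [b]. *)
Lemma lifted_height_image (alpha : R -> M) :
  transverse_arc (p @` half_lattice L) (leaves (L := L) (p := p)) alpha ->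
  lifted_height (p := p) (hinv f \o alpha) = `|b|^-1 * lifted_height (p := p) alpha.
Proof.
move=> aT; have aS := transverse_arc_no_cone aT.
have [g [cg gl]] := within_path_lifting pC aT.1 aS.
have gl' : lifts_path (p := p) (diagonal a^-1 b^-1 \o g) (hinv f \o alpha).
  split; last by move=> t tI; rewrite /= -gl // hinvE.
  by move=> t; apply: continuous_comp; [exact: cg | exact: diagonal_continuous].
rewrite (lifted_heightE pC (conj cg gl)) // (lifted_heightE pC gl') //; last first.
  move=> t tI; rewrite /= -gl // hinvE => /(coneP pC) Pt.
  apply: (aS t tI); rewrite -gl //; apply/(coneP pC)/half_lattice_diagonal.
  move: Pt; rewrite -half_lattice_diagonal diagonal_comp !mulfV // diagonal1.
  by move/half_lattice_diagonal.
by rewrite /= -mulrBr normrM normfV.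
Qed.

End LinearAction.

(** * Metric properties of the cover *)

Section MetricCover.
Context {R : realType} {M : metricType R}.
Local Notation plane := (R * R)%type.
Context {L : set plane} {c : R} {p : plane -> M}.
Hypothesis pC : flat_cover L c p.
Hypothesis cM : compact [set: M].

(** The deck transformations are isometries. *)
Lemma fiber_transport z v w : p z = p v ->
  exists2 w', p w' = p w & `|w' - v| = `|w - z|.
Proof.
move=> /(cover_fiber pC)[h|h].
- exists (w + (v - z)); last by congr (`| _ |); rewrite addrA addrAC addrK.
  by symmetry; apply/(cover_fiber pC); left; rewrite addrAC subrr add0r.
- exists (v + z - w); last by rewrite addrAC [v + z]addrC addrK distrC.
  by symmetry; apply/(cover_fiber pC); right; rewrite subrK.
Qed.

Lemma metric_nbhs (x : M) (e : R) : 0 < e -> nbhs x [set y | mdist x y < e].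
Proof. by move=> e0; have := nbhsx_ballx x e e0; rewrite ballEmdist. Qed.

Lemma nbhs_metric (x : M) (W : set M) : nbhs x W ->
  exists2 e, 0 < e & forall y, mdist x y < e -> W y.
Proof.
move=> /nbhs_ballP[e /= e0 eW]; exists e => // y xy; apply: eW.
by rewrite ballEmdist.
Qed.

(** A uniform version of a local property: on a compact space a
positive threshold that works locally can be chosen independently of the
point. *)
Lemma compact_uniform (Q : R -> M -> Prop) :
  (forall x : M, exists2 e, 0 < e &
     \forall y \near x, forall d, 0 < d -> d < e -> Q d y) ->
  exists2 d, 0 < d & forall x, Q d x.
Proof.
move=> loc; have near_cov := iffLR (compact_near_coveringP _) cM.
have : \forall d \near (0 : R)^'+, [set: M] `<=` (fun x => 0 < d /\ Q d x).
  apply: (near_cov R (0 : R)^'+ (fun d x => 0 < d /\ Q d x)) => x _.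
  have [e e0 ne] := loc x.
  exists ([set y | forall d, 0 < d -> d < e -> Q d y], [set d | 0 < d /\ d < e]).
    split=> //=; near=> d; split; near: d; first exact: nbhs_right_gt.
    exact: nbhs_right_lt.
  by move=> [y d] /= [h [d0 de]]; split=> //; exact: h.
move=> near_d; have [d dQ] := @filter_ex _ _ (at_right_proper_filter (0 : R)) _ near_d.
have [d0 _] := dQ (p 0) I.
by exists d => // x; have [] := dQ x I.
Unshelve. all: by end_near. Qed.

Lemma cover_uniformly_continuous e : 0 < e ->
  exists2 d, 0 < d & forall z w, `|w - z| < d -> mdist (p z) (p w) < e.
Proof.
move=> e0.
have [|d d0 dQ] := @compact_uniform (fun d x => forall z w : plane, p z = x ->
    `|w - z| < d -> mdist x (p w) < e); last first.
  by exists d => // z w; exact: dQ.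
move=> x; have [z0 zE] := cover_surj pC x; subst x.
have e2 : 0 < e / 2 by rewrite divr_gt0.
have [r r0 rP] := iffLR (nbhs_plane _ _)
   (cover_continuous pC (metric_nbhs (p z0) e2)).
have r2 : 0 < r / 2 by rewrite divr_gt0.
exists (r / 2) => //.
have nz : nbhs z0 [set w | `|w - z0| < r / 2] by apply/nbhs_plane; exists (r / 2).
apply: filterS (cover_nbhs pC nz) => _ [v vz <-] d d0 dr z w pz wz.
have [w' <- w'v] := fiber_transport w pz.
have h1 : mdist (p z0) (p w') < e / 2.
  apply: rP; have := ler_distD v w' z0; rewrite w'v; move: vz => /=; lra.
have h2 : mdist (p z0) (p v) < e / 2 by apply: rP; move: vz => /=; lra.
have := metric_triangle (p v) (p z0) (p w'); rewrite (metric_sym (p v) (p z0)); lra.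
Qed.

(** Nearby points of [M] have nearby lifts, with a modulus that
depends neither on the points nor on the lift chosen for the first one.  This
holds at the cone points too, where lifts of paths are not unique; expansivity
and shadowing of [f] both reduce to the linear map through it. *)
Lemma close_lift e : 0 < e -> exists2 d, 0 < d &
  forall z y, mdist (p z) y < d -> exists2 w, p w = y & `|w - z| < e.
Proof.
move=> e0.
have [|d d0 dQ] := @compact_uniform (fun d x => forall (z : plane) y, p z = x ->
    mdist x y < d -> exists2 w, p w = y & `|w - z| < e); last first.
  by exists d => // z y; exact: dQ.
move=> x; have [z0 zE] := cover_surj pC x; subst x.
have e2 : 0 < e / 2 by rewrite divr_gt0.
have nz : nbhs z0 [set w | `|w - z0| < e / 2] by apply/nbhs_plane; exists (e / 2).
have [r r0 rP] := nbhs_metric (cover_nbhs pC nz).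
have r2 : 0 < r / 2 by rewrite divr_gt0.
exists (r / 2) => //; apply: filterS (metric_nbhs (p z0) r2) => x /= xz d d0 dr z y pz xy.
have [|v vz vx] := rP x; first lra.
have [|w wz wy] := rP y; first by have := metric_triangle (p z0) x y; lra.
have [w' pw' w'z] := fiber_transport w (etrans vx (esym pz)).
exists w'; first by rewrite pw'.
rewrite w'z; have := ler_distD z0 w v; rewrite (distrC z0 v).
by move: vz wz => /=; lra.
Qed.

(** Under the last hypothesis [E] is open in [C], and its
complement in [C] is open too. *)
Lemma connected_uniform_open (C E : set M) (d : R) : connected C -> E `<=` C ->
  E !=set0 -> 0 < d -> (forall x y, E x -> C y -> mdist x y < d -> E y) -> E = C.
Proof.
move=> conC EC E0 d0 Ed; apply: conC => //.
- exists (\bigcup_(x in E) (ball x d)°).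
    by apply: bigcup_open => x _; exact: open_interior.
  apply/seteqP; split=> [x Ex|y [Cy [x Ex /interior_subset xy]]].
    split; first exact: EC.
    by exists x => //; apply: nbhs_singleton; apply: nbhs_interior; exact: nbhsx_ballx.
  by apply: (Ed x) => //; move: xy; rewrite ballEmdist.
- exists (~` \bigcup_(x in C `\` E) (ball x d)°).
    by rewrite closedC; apply: bigcup_open => x _; exact: open_interior.
  apply/seteqP; split=> [x Ex|y [Cy nE]].
    split; first exact: EC.
    move=> [y [Cy nEy] /interior_subset]; rewrite ballEmdist /= => yx.
    by apply: nEy; apply: (Ed x) => //; rewrite metric_sym.
  apply: contrapT => nEy; apply: nE; exists y => //.
  by apply: nbhs_singleton; apply: nbhs_interior; exact: nbhsx_ballx.
Qed.

(** While its steps are shorter than [r], a chain of points that stays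
[r]-close to the fiber of [q] cannot escape from a region of diameter [O(r)].
If [q] is at distance at least [2 r] from the half lattice, the [r]-balls
around the points of its fiber are too far apart for the chain to jump from
one to another.  Otherwise the fiber has two points near the half-lattice point
[s], which the ball of radius [3 r] around [s] contains with their [r]-balls,
and its other points are far from this ball.  The bound [7 r <= c] is what the
triangle inequality requires in the second case. *)
Lemma fiber_trap (q : plane) (r : R) : 0 < r -> 7 * r <= c ->
  exists T : set plane, [/\ T q, (forall v, T v -> `|v - q| < 5 * r) &
    forall v w h, T v -> `|w - v| < r -> p h = p q -> `|h - w| < r -> T w].
Proof.
move=> r0 rc.
have [[s [Ps sq]]|nP] := pselect (exists s, half_lattice L s /\ `|q - s| < 2 * r).
- exists [set v | `|v - s| < 3 * r]; split=> /=; first by lra.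
    by move=> v vs; have := ler_distD s v q; rewrite (distrC s q); lra.
  move=> v w h vs wv phq hw.
  have hs : `|h - s| < 5 * r.
    have := ler_distD w h s; have := ler_distD v w s; lra.
  have qs : `|h - s| = `|q - s|.
    case/(cover_fiber pC): (phq) => Lh.
      congr (`| _ - s |); apply/eqP; rewrite eq_sym -subr_eq0; apply/eqP.
      apply: (lat_gap pC) => //.
      by have := ler_distD s q h; rewrite (distrC s h); lra.
    have e : (q - s) + (h - s) = 0.
      apply: (lat_gap pC); last by have := ler_normD (q - s) (h - s); lra.
      by rewrite addrACA -opprD; exact: (latB pC).
    by move/eqP: e; rewrite addrC addr_eq0 => /eqP ->; rewrite normrN.
  by have := ler_distD h w s; rewrite (distrC w h); lra.
- exists [set v | `|v - q| < r]; split=> /=; first by rewrite subrr normr0.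
    by move=> v; lra.
  move=> v w h vq wv phq hw.
  have hq : `|h - q| < 3 * r.
    by have := ler_distD w h q; have := ler_distD v w q; lra.
  suff <- : h = q by rewrite distrC.
  apply: (fiber_separated pC (esym phq)); first by lra.
  move=> Pm; apply: nP; exists (midpoint q h); split=> //.
  have -> : q - midpoint q h = 2^-1 *: (q - h).
    rewrite /midpoint scalerDr opprD -{1}[q]half_half scalerBr.
    by rewrite addrACA subrr add0r.
  by rewrite normrZ ger0_norm ?invr_ge0 // distrC; lra.
Qed.

Variables (a b : R) (f : homeomorphism M).
Hypotheses (a_lt1 : `|a| < 1) (a0 : a != 0) (b_gt1 : 1 < `|b|).
Hypothesis fE : forall z, f (p z) = p (diagonal a b z).
Hypothesis hinv_fE : forall z, hinv f (p z) = p (diagonal a^-1 b^-1 z).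

Let b0 : b != 0.
Proof. by rewrite -normr_gt0 (lt_trans _ b_gt1). Qed.

Lemma iterzE (n : int) z : iterz f n (p z) = p (diagonal (a ^ n) (b ^ n) z).
Proof.
case: n => k /=.
- elim: k => [|k IH]; first by rewrite !expr0z diagonal1.
  by rewrite iterS IH fE diagonal_comp -!exprSz.
- have iE m : iter m (hinv f) (p z) = p (diagonal (a^-1 ^+ m) (b^-1 ^+ m) z).
    elim: m => [|m IH]; first by rewrite !expr0 diagonal1.
    by rewrite iterS IH hinv_fE diagonal_comp -!exprS.
  by rewrite -iterS iE !exprVn.
Qed.

(** * Continuum-wise expansivity *)

Lemma diagonal_norm_le (u v K : R) (z : plane) : `|u| <= K -> `|v| <= K ->
  `|diagonal u v z| <= K * `|z|.
Proof.
move=> uK vK; rewrite !prod_normE /= ge_max !normrM.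
have K0 : 0 <= K by exact: le_trans uK.
by apply/andP; split; apply: ler_pM => //; rewrite le_max lexx ?orbT.
Qed.

Lemma diagonal_norm_ge1 (u v : R) (z : plane) : `|u| * `|z.1| <= `|diagonal u v z|.
Proof. by rewrite prod_normE /= le_max !normrM lexx. Qed.

Lemma diagonal_norm_ge2 (u v : R) (z : plane) : `|v| * `|z.2| <= `|diagonal u v z|.
Proof. by rewrite prod_normE /= le_max !normrM lexx orbT. Qed.

Lemma common_bound (l : seq R) : exists2 K, 0 < K & forall x, x \in l -> `|x| <= K.
Proof.
elim: l => [|x l [K K0 KP]]; first by exists 1.
exists (Num.max K `|x|); first by rewrite lt_max K0.
by move=> y; rewrite inE le_max => /orP[/eqP ->|/KP ->] //; rewrite lexx orbT.
Qed.

Lemma exp_unbounded (x y : R) : 1 < x -> exists k : nat, y < x ^+ k.+1.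
Proof.
move=> x1; have h0 : 0 < x - 1 by rewrite subr_gt0.
have bernoulli k : 1 + k%:R * (x - 1) <= x ^+ k.
  elim: k => [|k IH]; first by rewrite expr0 mul0r addr0.
  have x0 : 0 <= x by rewrite ltW // (lt_trans ltr01).
  rewrite exprS -[k.+1%:R]natr1; apply: le_trans (ler_wpM2l x0 IH).
  have := mulr_ge0 (ler0n R k) (sqr_ge0 (x - 1)); lra.
have [k kP] : exists k : nat, `|y| / (x - 1) < k%:R.
  by exists (Num.bound (`|y| / (x - 1))); apply: archi_boundP; rewrite divr_ge0 // ltW.
exists k; rewrite ltr_pdivrMr // in kP.
have := bernoulli k.+1; rewrite -[k.+1%:R]natr1.
by have := ler_norm y; lra.
Qed.

(** A continuum need not lift to the plane, but closeness
propagates along it.  For [n] large, consider the points of [C] that have a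
lift [w] whose images by the [n]-th forward and backward iterates of the matrix
lie in the regions of [fiber_trap] around the images of [z].  Since the
iterates of [C] are small, this set is relatively open and closed in [C], hence
equal to [C].  As the two iterates expand one coordinate each, all of [C] has
lifts arbitrarily close to [z]. *)
Lemma cover_cw_expansive : cw_expansive f.
Proof.
have c0 := lat_gap_gt0 pC.
set r := c / 7; have r0 : 0 < r by rewrite divr_gt0.
have rc : 7 * r <= c by rewrite /r; lra.
have [d0 d0_gt0 lift0] := close_lift r0.
exists (d0 / 2); first by rewrite divr_gt0.
move=> C [[x Cx] _ conC] smallC.
have close n y y' : C y -> C y' -> mdist (iterz f n y) (iterz f n y') < d0.
  move=> Cy Cy'; suff : mdist (iterz f n y) (iterz f n y') <= d0 / 2 by lra.
  rewrite -lee_fin; apply: le_trans (smallC n).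
  by apply: ereal_sup_ubound; exists (iterz f n y), (iterz f n y'); split.
exists x; apply/seteqP; split=> [y Cy|_ ->] //=.
have [z zE] := cover_surj pC x; subst x.
suff dist_small e : 0 < e -> mdist (p z) y < e.
  apply/eqP; rewrite eq_sym; apply/eqP/mdist_positivity.
  apply/eqP; rewrite eq_le mdist_ge0 andbT; apply/ler_addgt0Pl => e e0.
  by rewrite addr0 ltW // dist_small.
move=> e0; have [d d_gt0 unif] := cover_uniformly_continuous e0.
have a1 : 1 < `|a^-1| by rewrite normfV invf_gt1 // normr_gt0.
have [kb kbP] := exp_unbounded (5 * r / d) b_gt1.
have [ka kaP] := exp_unbounded (5 * r / d) a1.
(* The forward iterate stretches the second coordinate and the backward one the
   first, by a factor that brings 5 r below d. *)
set n1 : int := kb.+1; set n2 : int := Negz ka.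
have [T1 [T1q T1r T1P]] := fiber_trap (diagonal (a ^ n1) (b ^ n1) z) r0 rc.
have [T2 [T2q T2r T2P]] := fiber_trap (diagonal (a ^ n2) (b ^ n2) z) r0 rc.
pose E := [set y | C y /\ exists w, [/\ p w = y,
   T1 (diagonal (a ^ n1) (b ^ n1) w) & T2 (diagonal (a ^ n2) (b ^ n2) w)]].
have [K K0 KP] := common_bound [:: a ^ n1; b ^ n1; a ^ n2; b ^ n2].
have rK : 0 < r / K by rewrite divr_gt0.
have [d1 d1_gt0 lift1] := close_lift rK.
have EC : E = C.
  apply: (connected_uniform_open conC (d := d1)) => //.
  - by move=> y' [].
  - by exists (p z); split=> //; exists z.
  move=> y' y'' [Cy' [w' [w'E T1w T2w]]] Cy'' y'y''; split=> //.
  have [w wE ww'] := lift1 w' y'' ltac:(by rewrite w'E).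
  have step n (T : set plane) :
      `|a ^ n| <= K -> `|b ^ n| <= K ->
      (forall v w h, T v -> `|w - v| < r ->
         p h = p (diagonal (a ^ n) (b ^ n) z) -> `|h - w| < r -> T w) ->
      T (diagonal (a ^ n) (b ^ n) w') -> T (diagonal (a ^ n) (b ^ n) w).
    move=> aK bK TP Tw'.
    have := close n _ _ Cy'' Cx; rewrite -wE !iterzE.
    move=> /lift0[h hE hw]; apply: (TP _ _ h Tw') => //.
    rewrite -diagonalB; apply: le_lt_trans (diagonal_norm_le _ aK bK) _.
    by rewrite mulrC -ltr_pdivlMr.
  by exists w; split=> //; [apply: (step n1 T1) | apply: (step n2 T2)] => //; apply: KP;
    rewrite !inE eqxx ?orbT.
move: Cy; rewrite -EC => -[_ [w [<- T1w T2w]]].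
apply: unif; rewrite prod_normE gt_max; apply/andP; split.
- have := T2r _ T2w; rewrite -diagonalB => h.
  have := le_lt_trans (diagonal_norm_ge1 _ _ _) h.
  have -> : `|a ^ n2| = `|a^-1| ^+ ka.+1 by rewrite -normrX exprVn.
  move: kaP; rewrite ltr_pdivrMr // => kaP h'.
  have ge0 := normr_ge0 (w - z).1.
  rewrite ltNge; apply/negP => dw; move: h'; rewrite ltNge => /negP; apply.
  apply: ltW; apply: lt_le_trans kaP _.
  by rewrite ler_pM2l // exprn_gt0 // (lt_trans ltr01).
- have := T1r _ T1w; rewrite -diagonalB => h.
  have := le_lt_trans (diagonal_norm_ge2 _ _ _) h.
  have -> : `|b ^ n1| = `|b| ^+ kb.+1 by rewrite -normrX.
  move: kbP; rewrite ltr_pdivrMr // => kbP h'.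
  rewrite ltNge; apply/negP => dw; move: h'; rewrite ltNge => /negP; apply.
  apply: ltW; apply: lt_le_trans kbP _.
  by rewrite ler_pM2l // exprn_gt0 // (lt_trans ltr01).
Qed.

(** * Shadowing *)

(** The intervals of the points whose orbit is at time [n] within
[e / (|beta| - 1)] of [u n] are nested, by the choice of the radius, and the
supremum of their lower ends belongs to all of them. *)
Lemma shadowing_forward (beta e : R) (u : nat -> R) : 1 < `|beta| -> 0 <= e ->
  (forall n, `|u n.+1 - beta * u n| <= e) ->
  exists u0, forall n : nat, `|beta ^+ n * u0 - u n| <= e / (`|beta| - 1).
Proof.
move=> beta1 e0 ue; set C := e / (`|beta| - 1).
have B0 : 0 < `|beta| - 1 by rewrite subr_gt0.
have nb0 : 0 < `|beta| by rewrite (lt_trans ltr01).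
have beta0 : beta != 0 by rewrite -normr_gt0.
have eC : e = C * (`|beta| - 1) by rewrite /C mulfVK // gt_eqF.
have C0 : 0 <= C by rewrite divr_ge0 // ltW.
(* The points whose n-th image is within C of u n form the interval of center
   v n and radius rho n. *)
pose v n := (beta ^+ n)^-1 * u n; pose rho n := C / `|beta| ^+ n.
have vstep n : `|v n.+1 - v n| <= rho n - rho n.+1.
  have -> : v n.+1 - v n = (beta ^+ n.+1)^-1 * (u n.+1 - beta * u n).
    by rewrite /v mulrBr exprS invfM; congr (_ - _); rewrite mulrACA mulVf // mul1r.
  have -> : rho n - rho n.+1 = (`|beta| ^+ n.+1)^-1 * e.
    rewrite /rho eC exprS; field.
    by rewrite expf_neq0 // gt_eqF.
  rewrite normrM normfV normrX ler_wpM2l // invr_ge0 exprn_ge0 //.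
have lo n m : v n - rho n <= v (n + m)%N - rho (n + m)%N.
  elim: m => [|m IH]; first by rewrite addn0.
  apply: le_trans IH _; rewrite addnS.
  by have := vstep (n + m)%N; rewrite ler_norml => /andP[]; lra.
have hi n m : v (n + m)%N + rho (n + m)%N <= v n + rho n.
  elim: m => [|m IH]; first by rewrite addn0.
  apply: le_trans _ IH; rewrite addnS.
  by have := vstep (n + m)%N; rewrite ler_norml => /andP[]; lra.
have rho0 n : 0 <= rho n by rewrite divr_ge0 // exprn_ge0.
have lohi n m : v n - rho n <= v m + rho m.
  have := lo n m; have := hi m n; rewrite addnC.
  by have := rho0 (n + m)%N; lra.
pose A := [set v n - rho n | n in [set: nat]].
have hsA : has_sup A.
  by split; [exists (v 0 - rho 0), 0%N | exists (v 0 + rho 0) => _ [n _ <-]].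
exists (sup A) => n.
have h1 : v n - rho n <= sup A by apply: ub_le_sup; [case: hsA | exists n].
have h2 : sup A <= v n + rho n by apply: ge_sup; [case: hsA | move=> _ [m _ <-]].
have -> : beta ^+ n * sup A - u n = beta ^+ n * (sup A - v n).
  by rewrite mulrBr /v mulVKf // expf_neq0.
rewrite normrM normrX; apply: le_trans (_ : `|beta| ^+ n * rho n <= _).
  by rewrite ler_wpM2l ?exprn_ge0 // ler_norml; apply/andP; split; lra.
by rewrite /rho mulrC divfK // expf_neq0 // gt_eqF.
Qed.

(** Towards the past the error contracts. *)
Lemma shadowing_expanding (beta e : R) (u : int -> R) : 1 < `|beta| -> 0 <= e ->
  (forall n : int, `|u (n + 1) - beta * u n| <= e) ->
  exists u0, forall n : int, `|beta ^ n * u0 - u n| <= e / (`|beta| - 1).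
Proof.
move=> beta1 e0 ue; have [|u0 u0P] := @shadowing_forward beta e (fun n => u n) beta1 e0.
  by move=> n; rewrite -addn1 PoszD.
set C := e / (`|beta| - 1) in u0P *.
have B0 : 0 < `|beta| - 1 by rewrite subr_gt0.
have nb0 : 0 < `|beta| by rewrite (lt_trans ltr01).
have beta0 : beta != 0 by rewrite -normr_gt0.
have eC : e = C * (`|beta| - 1) by rewrite /C mulfVK // gt_eqF.
have back n : `|beta ^ (n + 1) * u0 - u (n + 1)| <= C -> `|beta ^ n * u0 - u n| <= C.
  move=> h; rewrite -(ler_pM2l nb0) -normrM.
  have -> : beta * (beta ^ n * u0 - u n) =
     (beta ^ (n + 1) * u0 - u (n + 1)) + (u (n + 1) - beta * u n).
    by rewrite exprzDr ?unitfE // expr1z; ring.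
  apply: le_trans (ler_normD _ _) _; have := ue n; rewrite eC; lra.
exists u0; case=> n; first exact: u0P.
elim: n => [|n IH]; apply: back.
  by rewrite (_ : Negz 0 + 1 = 0) //; exact: (u0P 0%N).
rewrite (_ : Negz n.+1 + 1 = Negz n) //.
by rewrite !NegzE -[n.+2]addn1 PoszD opprD subrK.
Qed.

(** The previous lemma for the reversed sequence. *)
Lemma shadowing_contracting (alpha e : R) (s : int -> R) :
  alpha != 0 -> `|alpha| < 1 -> 0 <= e ->
  (forall n : int, `|s (n + 1) - alpha * s n| <= e) ->
  exists s0, forall n : int, `|alpha ^ n * s0 - s n| <= e / (1 - `|alpha|).
Proof.
move=> al0 al1 e0 se.
have na0 : 0 < `|alpha| by rewrite normr_gt0.
have i1 : 1 < `|alpha^-1| by rewrite normfV invf_gt1.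
have [|n|s0 s0P] := @shadowing_expanding alpha^-1 (e / `|alpha|) (fun n => s (- n)) i1.
- by rewrite divr_ge0.
- have := se (- (n + 1)); rewrite opprD subrK => h.
  have -> : s (- n - 1) - alpha^-1 * s (- n) =
      - (alpha^-1 * (s (- n) - alpha * s (- n - 1))).
    by rewrite mulrBr mulKf // opprB.
  by rewrite normrN normrM normfV mulrC ler_wpM2r // invr_ge0.
exists s0 => n; have := s0P (- n); rewrite opprK exprz_inv opprK.
suff -> : e / `|alpha| / (`|alpha^-1| - 1) = e / (1 - `|alpha|) by [].
by rewrite normfV -mulrA -invfM mulrBr mulfV ?gt_eqF // mulr1.
Qed.

Lemma lift_sequence (y : nat -> M) (z0 : plane) (close : plane -> plane -> Prop) :
  p z0 = y 0%N ->
  (forall n z, p z = y n -> exists2 w, p w = y n.+1 & close z w) ->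
  exists s : nat -> plane,
    [/\ s 0%N = z0, forall n, p (s n) = y n & forall n, close (s n) (s n.+1)].
Proof.
move=> pz0 next.
pose s := fix s n := if n is m.+1
  then xget z0 [set w | p w = y m.+1 /\ close (s m) w] else z0.
have sP n : p (s n) = y n -> p (s n.+1) = y n.+1 /\ close (s n) (s n.+1).
  move=> /next[w pw cw]; rewrite /=; case: xgetP => [v _ //|/(_ w) h].
  by case: h.
have sy n : p (s n) = y n by elim: n => [//|n /sP[]].
by exists s; split=> // n; have [] := sP n (sy n).
Qed.

(** A pseudo orbit lifts, point after point, to a pseudo orbit of the
linear map: [close_lift] corrects each lift, forwards from the image of the
previous point and backwards from the preimage of the next one.  The two
coordinates of the lifted sequence are shadowed independently. *)
Lemma cover_shadowing : shadowing f.
Proof.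
move=> eps eps0; have [d d0 unif] := cover_uniformly_continuous eps0.
set m := Num.min (`|b| - 1) (1 - `|a|).
have m0 : 0 < m by rewrite lt_min !subr_gt0 b_gt1.
set e := d * m / 2; have e0 : 0 < e by rewrite !mulr_gt0.
have esmall h : m <= h -> e / h < d.
  move=> mh; rewrite ltr_pdivrMr ?(lt_le_trans m0) //.
  apply: lt_le_trans (_ : d * m <= _); last by rewrite ler_pM2l.
  by rewrite /e ltr_pdivrMr // ltr_pMr ?mulr_gt0 // ltr1n.
have [del del0 lift] := close_lift e0.
exists del => // x px; have [z0 z0E] := cover_surj pC (x 0).
have [fw [fw0 fwx fwc]] : exists s : nat -> plane, [/\ s 0%N = z0,
    forall n, p (s n) = x n & forall n, `|s n.+1 - diagonal a b (s n)| < e].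
  apply: (@lift_sequence (fun n => x n) z0 (fun z w => `|w - diagonal a b z| < e)).
    by [].
  move=> n z zE; apply: lift; rewrite -fE zE.
  by have := px n; rewrite -addn1 PoszD.
have [bw [bw0 bwx bwc]] : exists s : nat -> plane, [/\ s 0%N = z0,
    forall n, p (s n) = x (- n%:Z) & forall n, `|s n - diagonal a b (s n.+1)| < e].
  apply: (@lift_sequence (fun n => x (- n%:Z)) z0
    (fun z w => `|z - diagonal a b w| < e)); first by rewrite oppr0.
  move=> n z zE; set x' := x (- n.+1%:Z).
  have close : mdist (p z) (f x') < del.
    have nE : - n.+1%:Z + 1 = - n%:Z by rewrite -addn1 PoszD opprD subrK.
    by rewrite zE -nE metric_sym; exact: px.
  have [v vE vz] := lift _ _ close; exists (diagonal a^-1 b^-1 v).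
    by rewrite -hinv_fE vE hfunK.
  by rewrite diagonal_comp !mulfV // diagonal1 distrC.
pose w (n : int) := match n with Posz k => fw k | Negz k => bw k.+1 end.
have wx n : p (w n) = x n.
  by case: n => n /=; rewrite ?fwx // bwx NegzE.
have wc n : `|w (n + 1) - diagonal a b (w n)| < e.
  case: n => [n|[|n]].
  - have -> : Posz n + 1 = Posz n.+1 by rewrite -addn1 PoszD.
    exact: fwc.
  - have -> : Negz 0 + 1 = Posz 0 by [].
    by rewrite /= fw0 -bw0.
  - have -> : Negz n.+1 + 1 = Negz n.
      by rewrite !NegzE -[n.+2]addn1 PoszD opprD subrK.
    exact: bwc.
have wc1 n : `|(w (n + 1)).1 - a * (w n).1| <= e.
  by apply: ltW; apply: le_lt_trans (wc n); rewrite prod_normE /= le_max lexx.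
have wc2 n : `|(w (n + 1)).2 - b * (w n).2| <= e.
  by apply: ltW; apply: le_lt_trans (wc n); rewrite prod_normE /= le_max lexx orbT.
have [s0 s0P] := shadowing_contracting (s := fun n => (w n).1) a0 a_lt1 (ltW e0) wc1.
have [u0 u0P] := shadowing_expanding (u := fun n => (w n).2) b_gt1 (ltW e0) wc2.
exists (p (s0, u0)) => n; rewrite iterzE -wx metric_sym; apply: unif.
rewrite prod_normE /= gt_max; apply/andP; split.
- by apply: le_lt_trans (s0P n) _; apply: esmall; rewrite ge_min lexx orbT.
- by apply: le_lt_trans (u0P n) _; apply: esmall; rewrite ge_min lexx.
Qed.

End MetricCover.

(** * The pseudo-Anosov structure *)

Section PseudoAnosov.
Context {R : realType} {M : topologicalType}.
Local Notation plane := (R * R)%type.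
Context {L : set plane} {c : R} {p : plane -> M}.
Hypothesis pC : flat_cover L c p.
Variables (a b lam : R) (f : homeomorphism M).
Hypotheses (lam1 : 1 < lam) (aE : `|a| = lam^-1) (bE : `|b| = lam).
Hypothesis Lab : forall v, L v -> L (diagonal a b v).
Hypothesis Lba : forall v, L v -> L (diagonal a^-1 b^-1 v).
Hypothesis fE : forall z, f (p z) = p (diagonal a b z).

Lemma cover_pseudo_anosov : @pseudo_anosov R M f.
Proof.
have lam0 : 0 < lam by exact: lt_trans lam1.
have a0 : a != 0 by rewrite -normr_gt0 aE invr_gt0.
have b0 : b != 0 by rewrite -normr_gt0 bE.
have pC' := flat_cover_flip pC.
have cones := flip_cones (p := p) (L := L).
have flip_diag x y z : flip (diagonal x y z) = diagonal y x (flip z) by [].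
have fE' z : f ((p \o flip) z) = (p \o flip) (diagonal b a z).
  by rewrite /= fE flip_diag.
have Lba' v : (flip @^-1` L) v -> (flip @^-1` L) (diagonal b a v).
  by move=> Lv; rewrite /= flip_diag; exact: Lab.
have Lab' v : (flip @^-1` L) v -> (flip @^-1` L) (diagonal b^-1 a^-1 v).
  by move=> Lv; rewrite /= flip_diag; exact: Lba.
exists lam, (p @` half_lattice L), (leaves (L := L) (p := p)),
  (leaves (L := flip @^-1` L) (p := p \o flip)),
  (lifted_height (p := p)), (lifted_height (p := p \o flip)).
split; split => //.
- exact: cone_finite pC.
- by split; [exact: leaves_singular_foliation pC | exact: lifted_height_measure pC].
- rewrite -cones.
  by split; [exact: leaves_singular_foliation pC' | exact: lifted_height_measure pC'].
- exact: leaves_transverse pC.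
- exact: (leaves_image pC a0 b0 Lab Lba fE).
- exact: (leaves_image pC' b0 a0 Lba' Lab' fE').
- by move=> alpha aT; rewrite (lifted_height_image pC a0 b0 Lab Lba fE) // bE.
- rewrite -cones => alpha aT.
  by rewrite (lifted_height_image pC' b0 a0 Lba' Lab' fE') // aE invrK.
Qed.

End PseudoAnosov.

(** * The pillow and the sphere *)

Section Pillow.
Context {R : realType}.
Local Notation plane := (R * R)%type.

Definition tau : R := 2 * pi.

Lemma tau_gt0 : 0 < tau.
Proof. by rewrite mulr_gt0 // pi_gt0. Qed.

Lemma cos_period (x : R) (m : int) : cos (x + tau * m%:~R) = cos x.
Proof.
have nat_case y (k : nat) : cos (y + tau * k%:R) = cos y.
  have -> : tau * k%:R = (pi *+ 2) *+ k by rewrite /tau -[RHS]mulr_natr -[pi *+ 2]mulr_natr; ring.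
  exact: (periodicn (@cosD2pi R)).
case: m => k; first exact: nat_case.
rewrite NegzE mulrNz mulrN.
by have := nat_case (x - tau * k.+1%:R) k.+1; rewrite subrK => ->.
Qed.

Lemma sin_period (x : R) (m : int) : sin (x + tau * m%:~R) = sin x.
Proof. by rewrite -!cosBpihalf addrAC cos_period. Qed.

(** Modulo the sign, a half period is a fundamental domain; the cosine
is injective on it. *)
Lemma cos_reduce (x : R) : exists (t : R) (m : int),
  0 <= t <= pi /\ (x = t + tau * m%:~R \/ x = - t + tau * m%:~R).
Proof.
have t0 := tau_gt0; set n := Num.floor (x / tau).
have n1 : n%:~R <= x / tau by exact: floor_le.
have n2 : x / tau < n%:~R + 1 by rewrite -intrD1 floorD1_gt.
rewrite ler_pdivlMr // in n1; rewrite ltr_pdivrMr // in n2.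
have [h|h] := leP (x - tau * n%:~R) pi.
  exists (x - tau * n%:~R), n; split; last by left; rewrite subrK.
  by apply/andP; split; lra.
exists (tau - (x - tau * n%:~R)), (n + 1); split.
  by rewrite /tau in n2 h *; apply/andP; split; lra.
by right; rewrite intrD; ring.
Qed.

Lemma cos_eq (x y : R) : cos x = cos y ->
  exists m : int, y = x + tau * m%:~R \/ y = - x + tau * m%:~R.
Proof.
have [t [m [tI xE]]] := cos_reduce x; have [u [n [uI yE]]] := cos_reduce y.
have -> : cos x = cos t by case: xE => ->; rewrite cos_period ?cosN.
have -> : cos y = cos u by case: yE => ->; rewrite cos_period ?cosN.
move/cos_inj; rewrite !in_itv /= => /(_ tI uI) tu; subst u.
case: xE yE => -> [] ->.
- by exists (n - m); left; rewrite intrB; ring.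
- by exists (n + m); right; rewrite intrD; ring.
- by exists (n + m); right; rewrite intrD; ring.
- by exists (n - m); left; rewrite intrB; ring.
Qed.

Lemma sin_eq0 (x : R) : sin x = 0 -> exists m : int, - x = x + tau * m%:~R.
Proof.
move=> sx; have : cos 0 = cos (x + x) :> R.
  by rewrite cos0 cosD sx mulr0 subr0 -expr2 cos2sin2 sx expr0n subr0.
move=> /cos_eq[m]; rewrite oppr0 !add0r => xx.
have e : x + x = tau * m%:~R by case: xx.
by exists (- m); rewrite intrN; lra.
Qed.

Definition pillow_norm (x y : R) : R := Num.sqrt (1 + (cos x * cos y) ^+ 2).

Lemma pillow_norm_gt0 x y : 0 < pillow_norm x y.
Proof. by rewrite sqrtr_gt0 ltr_pwDl // sqr_ge0. Qed.

Lemma pillow_norm_sqr x y : pillow_norm x y ^+ 2 = 1 + (cos x * cos y) ^+ 2.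
Proof. by rewrite sqr_sqrtr // addr_ge0 ?sqr_ge0. Qed.

Definition triple (a b c : R) : 'rV[R]_3 := \row_(i < 3) [:: a; b; c]`_i.

Lemma triple_sum a b c :
  \sum_(i < 3) (triple a b c) 0 i ^+ 2 = a ^+ 2 + b ^+ 2 + c ^+ 2.
Proof. by rewrite !big_ord_recl big_ord0 !mxE /= addr0 addrA. Qed.

Lemma sinsq (x : R) : sin x ^+ 2 = 1 - cos x ^+ 2.
Proof. by have := cos2Dsin2 x; lra. Qed.

Lemma pillow_on_sphere x y :
  \sum_(i < 3) (triple (cos x / pillow_norm x y) (cos y / pillow_norm x y)
     (sin x * sin y / pillow_norm x y)) 0 i ^+ 2 == 1.
Proof.
rewrite triple_sum !expr_div_n pillow_norm_sqr -!mulrDl !exprMn !sinsq.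
apply/eqP; rewrite (_ : cos x ^+ 2 + cos y ^+ 2 + (1 - cos x ^+ 2) * (1 - cos y ^+ 2) =
  1 + cos x ^+ 2 * cos y ^+ 2); last by ring.
by rewrite mulfV // gt_eqF // ltr_pwDl // mulr_ge0 // sqr_ge0.
Qed.

(** The points [(A, B, C)] with [|A|, |B| <= 1] and
[C ^ 2 = (1 - A ^ 2) (1 - B ^ 2)] form a pillow, parametrized by
[A = cos x], [B = cos y], [C = sin x sin y].  It is star-shaped with respect to
the origin, and since [A ^ 2 + B ^ 2 + C ^ 2 = 1 + (A B) ^ 2] its radial
projection to the sphere is the division by [pillow_norm]. *)
Definition pillow (x y : R) : S2 R :=
  exist (fun v : 'rV[R]_3 => \sum_(i < 3) v 0 i ^+ 2 == 1) _ (pillow_on_sphere x y).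

(** Radial projection is injective on the pillow: with [t = A B] the
product of the first two coordinates of the projection is [t / (1 + t ^ 2)],
which is an injective function of [t] on [[-1, 1]], so the projection determines
[t] and hence [pillow_norm]. *)
Lemma pillow_coords x y x' y' : pillow x y = pillow x' y' <->
  [/\ cos x = cos x', cos y = cos y' & sin x * sin y = sin x' * sin y'].
Proof.
split=> [e|[ex ey exy]]; last first.
  by apply: val_inj; rewrite /= /pillow_norm ex ey exy.
have co (i : 'I_3) : val (pillow x y) 0 i = val (pillow x' y') 0 i by rewrite e.
have := co ord0; have := co (lift ord0 ord0); have := co (lift ord0 (lift ord0 ord0)).
rewrite /= !mxE /= {co e}.
have n0 := pillow_norm_gt0 x y; have n0' := pillow_norm_gt0 x' y'.
have n2 := pillow_norm_sqr x y; have n2' := pillow_norm_sqr x' y'.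
set n := pillow_norm x y in n0 n2 *; set n' := pillow_norm x' y' in n0' n2' *.
set t := cos x * cos y in n2; set t' := cos x' * cos y' in n2'.
have cc u v : `|cos u * cos v| <= 1 :> R.
  by rewrite normrM mulr_ile1 ?normr_ge0 // ler_norml cos_geN1 cos_le1.
(* u / (1 + u^2) is injective on [-1, 1] *)
have tt : forall u v : R, `|u| <= 1 -> `|v| <= 1 -> u * (1 + v ^+ 2) = v * (1 + u ^+ 2) -> u = v.
  move=> u v; rewrite !ler_norml => /andP[u1 u2] /andP[v1 v2] uv.
  have /eqP : (u - v) * (1 - u * v) = 0 by lra.
  rewrite mulf_eq0 => /orP[]; rewrite subr_eq0 => /eqP // e.
  have : (u - v) ^+ 2 <= 0 by nra.
  by rewrite le_eqVlt ltNge sqr_ge0 orbF sqrf_eq0 subr_eq0 => /eqP.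
move=> e3 e2 e1.
have nz : n != 0 by rewrite gt_eqF.
have nz' : n' != 0 by rewrite gt_eqF.
have f1 : cos x * n' = cos x' * n.
  by move/eqP: e1; rewrite eqr_div // => /eqP.
have f2 : cos y * n' = cos y' * n.
  by move/eqP: e2; rewrite eqr_div // => /eqP.
have f3 : sin x * sin y * n' = sin x' * sin y' * n.
  by move/eqP: e3; rewrite eqr_div // => /eqP.
have ttE : t = t'.
  apply: tt; [exact: cc | exact: cc | rewrite -n2 -n2' /t /t' !expr2].
  have -> : cos x * cos y * (n' * n') = (cos x * n') * (cos y * n') by ring.
  by rewrite f1 f2; ring.
have nn : n = n'.
  by apply/eqP; rewrite -(eqrXn2 (ltn0Sn 1)) ?ltW // n2 n2' ttE.
rewrite -nn in f1 f2 f3.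
by split; apply: (mulIf nz).
Qed.

(** The cosines determine [x] and [y] up to sign and periods, and the
product of the sines excludes that the two signs differ, unless one of the
sines vanishes, and then the corresponding sign is free. *)
Lemma pillow_fiber x y x' y' : pillow x y = pillow x' y' <->
  exists m n : int, (x' = x + tau * m%:~R /\ y' = y + tau * n%:~R) \/
                    (x' = - x + tau * m%:~R /\ y' = - y + tau * n%:~R).
Proof.
split; last first.
  move=> [m [n [[-> ->]|[-> ->]]]]; apply/pillow_coords.
    by rewrite !cos_period !sin_period.
  by rewrite !cos_period !sin_period !cosN !sinN mulrNN.
move=> /pillow_coords[/cos_eq[m xx] /cos_eq[n yy] e].
case: xx yy => xE [] yE.
- by exists m, n; left.
- move: e; rewrite xE yE !sin_period sinN mulrN => /eqP.
  rewrite -addr_eq0 -mulr2n -mulr_natl mulf_eq0 pnatr_eq0 /= mulf_eq0.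
  move=> /orP[] /eqP /sin_eq0[k kE].
    by exists (m - k), n; right; rewrite intrB kE; split=> //; ring.
  by exists m, (n + k); left; rewrite intrD kE; split=> //; ring.
- move: e; rewrite xE yE !sin_period sinN mulNr => /eqP.
  rewrite -addr_eq0 -mulr2n -mulr_natl mulf_eq0 pnatr_eq0 /= mulf_eq0.
  move=> /orP[] /eqP /sin_eq0[k kE].
    by exists (m + k), n; left; rewrite intrD kE; split=> //; ring.
  by exists m, (n - k); right; rewrite intrB kE; split=> //; ring.
- by exists m, n; right.
Qed.

(** The ray through [(p, q, r)] meets the pillow at the factor [k] with
[k ^ 2 = T], where [T] is the smaller root of [p ^ 2 q ^ 2 T ^ 2 - T + 1 = 0];
the formula [T = 2 / (1 + D)] also covers the case [p q = 0]. *)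
Lemma pillow_surj (v : S2 R) : exists x y, pillow x y = v.
Proof.
case: v => v vS.
have [p [q [r [vE pqr]]]] : exists p q r, v = triple p q r /\ p ^+ 2 + q ^+ 2 + r ^+ 2 = 1.
  exists (v 0 ord0), (v 0 (lift ord0 ord0)), (v 0 (lift ord0 (lift ord0 ord0))).
  split; last by move/eqP: vS; rewrite !big_ord_recl big_ord0 addr0 addrA.
  apply/rowP => i; rewrite mxE; case: i => [[|[|[|//]]] i3] /=; congr (v _ _);
    exact: val_inj.
set D := Num.sqrt (1 - 4 * (p * q) ^+ 2).
have pq0 : 0 <= 1 - 4 * (p * q) ^+ 2.
  have : (1 - 2 * p * q) * (1 + 2 * p * q) >= 0.
    by apply: mulr_ge0; have := sqr_ge0 (p - q); have := sqr_ge0 (p + q);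
       have := sqr_ge0 r; nra.
  by rewrite exprMn; nra.
have D0 : 0 <= D by exact: sqrtr_ge0.
have D2 : D ^+ 2 = 1 - 4 * (p * q) ^+ 2 by rewrite sqr_sqrtr.
set T := 2 / (1 + D).
have D1 : 1 + D != 0 by rewrite gt_eqF // ltr_pwDl.
have T0 : 0 < T by rewrite divr_gt0 // ltr_pwDl.
have TE : T * (1 + D) = 2 by rewrite /T divfK.
have TT : 1 + T ^+ 2 * (p * q) ^+ 2 = T.
  have -> : (p * q) ^+ 2 = (1 - D ^+ 2) / 4 by rewrite D2; field.
  by rewrite /T; field.
set k := Num.sqrt T; have k0 : 0 < k by rewrite sqrtr_gt0.
have k2 : k ^+ 2 = T by rewrite sqr_sqrtr // ltW.
(* 2 p^2 - 1 <= D because (2 p^2 - 1)^2 <= 1 - 4 p^2 q^2 on the sphere *)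
have bound s t : s ^+ 2 + t ^+ 2 <= 1 -> D ^+ 2 = 1 - 4 * (s * t) ^+ 2 ->
    -1 <= k * s <= 1.
  move=> st D2'; rewrite -ler_norml -(ler_pXn2r (n := 2)) ?nnegrE //.
  rewrite expr1n real_normK ?num_real // exprMn k2.
  suff h : 2 * s ^+ 2 <= 1 + D.
    rewrite -(ler_pM2r (ltr_pwDl ltr01 D0)) mul1r mulrAC TE //.
  case: (lerP (2 * s ^+ 2) 1) => hs; first by lra.
  suff : 2 * s ^+ 2 - 1 <= D by lra.
  rewrite -(ler_pXn2r (n := 2)) ?nnegrE //; last by lra.
  rewrite D2' exprMn; have := sqr_ge0 s; have := sqr_ge0 t; nra.
have kp : -1 <= k * p <= 1 by apply: (@bound p q) => //; have := sqr_ge0 r; lra.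
have kq : -1 <= k * q <= 1.
  by apply: (@bound q p); rewrite 1?[q * p]mulrC //; have := sqr_ge0 r; lra.
have sgn_ok : sin (acos (k * p)) * sin (acos (k * q)) = `|k * r|.
  rewrite !sin_acos // -sqrtrM; last first.
    by move: kp; rewrite -ler_norml -(ler_pXn2r (n := 2)) ?nnegrE // expr1n
      real_normK ?num_real // subr_ge0.
  rewrite -sqrtr_sqr; congr Num.sqrt.
  rewrite !exprMn k2 (_ : r ^+ 2 = 1 - p ^+ 2 - q ^+ 2); last by lra.
  transitivity (1 + T ^+ 2 * (p * q) ^+ 2 - T * p ^+ 2 - T * q ^+ 2); first by ring.
  by rewrite TT; ring.
have [y [cy sy]] : exists y, cos y = k * q /\ sin (acos (k * p)) * sin y = k * r.
  have [h|h] := leP 0 (k * r).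
    by exists (acos (k * q)); rewrite acosK ?in_itv // sgn_ok ger0_norm.
  exists (- acos (k * q)); rewrite cosN acosK ?in_itv // sinN mulrN sgn_ok.
  by rewrite ltr0_norm // opprK.
exists (acos (k * p)), y; apply: val_inj; rewrite /= vE.
have cx : cos (acos (k * p)) = k * p by rewrite acosK ?in_itv.
have -> : pillow_norm (acos (k * p)) y = k.
  rewrite /pillow_norm cx cy -[RHS]/(Num.sqrt T); congr Num.sqrt.
  by rewrite -TT -k2; ring.
have nk : k != 0 by rewrite gt_eqF.
by rewrite cx cy sy; congr triple; rewrite [k * _]mulrC mulfK.
Qed.

Lemma S2_continuous (T : topologicalType) (F : T -> S2 R) (x : T) :
  (forall i, {for x, continuous (fun t => val (F t) 0 i)}) -> {for x, continuous F}.
Proof.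
move=> cF; apply/cvg_ballP => e e0.
(* The halves leave room for the three coordinates, as 3 / 4 < 1. *)
have e2 : 0 < e / 2 by rewrite divr_gt0.
have ci i : \forall t \near x, `|val (F x) 0 i - val (F t) 0 i| < e / 2.
  by have /cvg_ballP/(_ _ e2) := cF i.
have c0 := ci ord0; have c1 := ci (lift ord0 ord0).
have c2 := ci (lift ord0 (lift ord0 ord0)).
near=> t; rewrite ballEmdist /= /mdist /= /sphere_dist !big_ord_recl big_ord0 addr0.
have h0 : `|val (F x) 0 ord0 - val (F t) 0 ord0| < e / 2 by near: t.
have h1 : `|val (F x) 0 (lift ord0 ord0) - val (F t) 0 (lift ord0 ord0)| < e / 2.
  by near: t.
have h2 : `|val (F x) 0 (lift ord0 (lift ord0 ord0)) -
            val (F t) 0 (lift ord0 (lift ord0 ord0))| < e / 2 by near: t.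
have sq (d : R) : `|d| < e / 2 -> d ^+ 2 < e ^+ 2 / 4.
  move=> de; rewrite -(real_normK (num_real d)) (_ : e ^+ 2 / 4 = (e / 2) ^+ 2).
    by rewrite ltr_pXn2r ?nnegrE // ltW.
  by field.
move: (sq _ h0) (sq _ h1) (sq _ h2) => {}h0 {}h1 {}h2.
rewrite -[ltRHS]ger0_norm ?(ltW e0) // -sqrtr_sqr ltr_sqrt ?exprn_gt0 //.
apply: lt_trans (ltrD h0 (ltrD h1 h2)) _.
by have := exprn_gt0 2 e0; move: (e ^+ 2) => e'; clear; lra.
Unshelve. all: by end_near. Qed.

End Pillow.

(** * The sphere as a quotient of the plane *)

Section SphereCover.
Context {R : realType}.
Local Notation plane := (R * R)%type.

Definition sqrt2 : R := Num.sqrt 2.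

Lemma sqrt2_sqr : sqrt2 * sqrt2 = 2.
Proof. by rewrite -expr2 sqr_sqrtr. Qed.

Lemma sqrt2_gt1 : 1 < sqrt2.
Proof. by rewrite -[X in X < _]sqrtr1 ltr_sqrt // ltr1n. Qed.

Lemma sqrt2_lt2 : sqrt2 < 2.
Proof. by have := sqrt2_sqr; have := sqrt2_gt1; nra. Qed.

(** The matrix with rows (1, 2) and (1, 1) has the eigenvalues
[1 - sqrt2] and [1 + sqrt2], and these are the eigencoordinates of the point
[(x, y)]. *)
Definition eigen_point (x y : R) : plane := (x - sqrt2 * y, x + sqrt2 * y).
Definition eigen_x (z : plane) : R := (z.1 + z.2) / 2.
Definition eigen_y (z : plane) : R := (z.2 - z.1) / (2 * sqrt2).

Lemma sqrt2_neq0 : sqrt2 != 0.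
Proof. by rewrite gt_eqF // (lt_trans ltr01 sqrt2_gt1). Qed.

Lemma eigen_pointK z : eigen_point (eigen_x z) (eigen_y z) = z.
Proof.
have h := sqrt2_neq0; case: z => s u.
by rewrite /eigen_point /eigen_x /eigen_y /=; congr (_, _); field.
Qed.

Lemma eigen_xK x y : eigen_x (eigen_point x y) = x.
Proof. by rewrite /eigen_x /eigen_point /=; field. Qed.

Lemma eigen_yK x y : eigen_y (eigen_point x y) = y.
Proof. by have h := sqrt2_neq0; rewrite /eigen_y /eigen_point /=; field. Qed.

Lemma eigen_pointB x y x' y' :
  eigen_point x y - eigen_point x' y' = eigen_point (x - x') (y - y').
Proof. by rewrite /eigen_point; congr (_, _) => /=; ring. Qed.

Lemma eigen_pointD x y x' y' :
  eigen_point x y + eigen_point x' y' = eigen_point (x + x') (y + y').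
Proof. by rewrite /eigen_point; congr (_, _) => /=; ring. Qed.

Definition lattice_point (m n : int) : plane :=
  eigen_point (tau * m%:~R) (tau * n%:~R).

Definition lattice : set plane := [set v | exists m n, v = lattice_point m n].

Definition sphere_cover (z : plane) : S2 R := pillow (eigen_x z) (eigen_y z).

Lemma sphere_cover_continuous : continuous sphere_cover.
Proof.
have c1 : continuous (fst : plane -> R) by move=> z; exact: cvg_fst.
have c2 : continuous (snd : plane -> R) by move=> z; exact: cvg_snd.
have cx : continuous eigen_x.
  by move=> z; apply: cvgM; [apply: cvgD; [exact: c1 | exact: c2] | exact: cvg_cst].
have cy : continuous eigen_y.
  by move=> z; apply: cvgM; [apply: cvgB; [exact: c2 | exact: c1] | exact: cvg_cst].
have ccx : continuous (cos \o eigen_x).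
  by move=> z; apply: continuous_comp; [exact: cx | exact: continuous_cos].
have ccy : continuous (cos \o eigen_y).
  by move=> z; apply: continuous_comp; [exact: cy | exact: continuous_cos].
have csx : continuous (sin \o eigen_x).
  by move=> z; apply: continuous_comp; [exact: cx | exact: continuous_sin].
have csy : continuous (sin \o eigen_y).
  by move=> z; apply: continuous_comp; [exact: cy | exact: continuous_sin].
have cn : continuous (fun z => (pillow_norm (eigen_x z) (eigen_y z))^-1).
  move=> z; apply: cvgV; first by rewrite gt_eqF // pillow_norm_gt0.
  apply: (@continuous_comp _ _ _ (fun z => 1 + (cos (eigen_x z) * cos (eigen_y z)) ^+ 2)
    Num.sqrt); last exact: sqrt_continuous.
  apply: cvgD; first exact: cvg_cst.
  by rewrite expr2; apply: cvgM; apply: cvgM; (exact: ccx || exact: ccy).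
move=> z; apply: S2_continuous => -[[|[|[|//]]] i3].
- have -> : (fun t => val (sphere_cover t) 0 (Ordinal i3)) =
     (fun t => cos (eigen_x t) * (pillow_norm (eigen_x t) (eigen_y t))^-1).
    by apply/funext => t; rewrite /= mxE.
  by apply: cvgM; [exact: ccx | exact: cn].
- have -> : (fun t => val (sphere_cover t) 0 (Ordinal i3)) =
     (fun t => cos (eigen_y t) * (pillow_norm (eigen_x t) (eigen_y t))^-1).
    by apply/funext => t; rewrite /= mxE.
  by apply: cvgM; [exact: ccy | exact: cn].
- have -> : (fun t => val (sphere_cover t) 0 (Ordinal i3)) =
     (fun t => sin (eigen_x t) * sin (eigen_y t) *
        (pillow_norm (eigen_x t) (eigen_y t))^-1).
    by apply/funext => t; rewrite /= mxE.
  by apply: cvgM; [apply: cvgM; [exact: csx | exact: csy] | exact: cn].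
Qed.

Lemma sphere_cover_fiber z w :
  sphere_cover z = sphere_cover w <-> lattice (w - z) \/ lattice (w + z).
Proof.
rewrite /sphere_cover -[in X in _ <-> X](eigen_pointK z) -[in X in _ <-> X](eigen_pointK w).
move: (eigen_x z) (eigen_y z) (eigen_x w) (eigen_y w) => x y x' y'.
rewrite eigen_pointB eigen_pointD; split.
- move=> /pillow_fiber[m [n [[-> ->]|[-> ->]]]]; [left | right]; exists m, n;
    by congr eigen_point; ring.
- have pt_inj a b a' b' : eigen_point a b = eigen_point a' b' -> a = a' /\ b = b'.
    move=> e; split; first by rewrite -(eigen_xK a b) e eigen_xK.
    by rewrite -(eigen_yK a b) e eigen_yK.
  move=> h; apply/pillow_fiber; case: h => -[m [n /pt_inj[e1 e2]]]; exists m, n.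
    by left; split; lra.
  by right; split; lra.
Qed.

Lemma lattice0 : lattice 0.
Proof.
by exists 0, 0; rewrite /lattice_point /eigen_point !mulr0 subr0 addr0.
Qed.

Lemma latticeB v w : lattice v -> lattice w -> lattice (v - w).
Proof.
move=> [m [n ->]] [m' [n' ->]]; exists (m - m'), (n - n').
by rewrite /lattice_point eigen_pointB !intrB !mulrBr.
Qed.

(** The exponent of 2 in [m ^ 2] is even and that in [2 n ^ 2] is
odd. *)
Lemma sqrt2_irrational (m n : int) : m%:~R = sqrt2 * n%:~R -> m = 0 /\ n = 0.
Proof.
move=> e; have e2 : (m * m)%:~R = (2 * (n * n))%:~R :> R.
  by rewrite !intrM e mulrACA sqrt2_sqr.
have {}e2 : (`|m| * `|m| = 2 * (`|n| * `|n|))%N.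
  by have /intr_inj := e2; move/(congr1 absz); rewrite !abszM.
have n0 : `|n|%N = 0%N.
  apply/eqP; rewrite -leqn0 leqNgt; apply/negP => n0.
  have m0 : (0 < `|m|)%N.
    rewrite lt0n; apply/eqP => m0; move: e2; rewrite m0 mul0n => /esym/eqP.
    by rewrite !muln_eq0 /= orbb -leqn0 leqNgt n0.
  have := congr1 (logn 2) e2; rewrite !lognM ?muln_gt0 ?n0 ?m0 //.
  by move/(congr1 odd); rewrite !oddD !addbb.
have m0 : `|m|%N = 0%N.
  by move: e2; rewrite n0 muln0 => /eqP; rewrite muln_eq0 orbb => /eqP.
by split; apply/eqP; rewrite -absz_eq0 ?m0 ?n0.
Qed.

Lemma lattice_irr1 v : lattice v -> v.1 = 0 -> v = 0.
Proof.
move=> [m [n ->]] /=; have t0 := tau_gt0 (R := R) => e.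
have [-> ->] : m = 0 /\ n = 0.
  apply: sqrt2_irrational; apply: (mulfI (negbT (gt_eqF t0))).
  by rewrite mulrCA; lra.
by rewrite /lattice_point /eigen_point !mulr0 subr0 addr0.
Qed.

Lemma lattice_irr2 v : lattice v -> v.2 = 0 -> v = 0.
Proof.
move=> [m [n ->]] /=; have t0 := tau_gt0 (R := R) => e.
have [-> /eqP] : m = 0 /\ - n = 0.
  apply: sqrt2_irrational; apply: (mulfI (negbT (gt_eqF t0))).
  by rewrite mulrCA intrN; lra.
rewrite oppr_eq0 => /eqP ->.
by rewrite /lattice_point /eigen_point !mulr0 subr0 addr0.
Qed.

Lemma lattice_countable : countable lattice.
Proof.
apply: (@sub_countable _ _ _ ((fun mn => lattice_point mn.1 mn.2) @` [set: int * int])).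
  by apply: subset_card_le => _ [m [n ->]]; exists (m, n).
by apply: sub_countable (countableP [set: int * int]); exact: card_image_le.
Qed.

Lemma lattice_gap v : lattice v -> `|v| < 1 -> v = 0.
Proof.
move=> [m [n ->]]; rewrite prod_normE gt_max /= !ltr_norml.
move=> /andP[/andP[u1 u2] /andP[s1 s2]].
have t4 : 4 <= tau :> R by rewrite /tau; have := pi_ge2 R; lra.
have small (k : int) (b : R) : 1 <= b -> `|b * (tau * k%:~R)| < 1 -> k = 0.
  move=> b1; rewrite normrM [`|tau * _|]normrM (ger0_norm (le_trans ler01 b1)).
  rewrite (ger0_norm (ltW tau_gt0)) => h; apply/eqP; apply: contraT => k0.
  have k1 : 1 <= `|k%:~R| :> R by apply: norm_intr_ge1; rewrite ?intr_int ?intr_eq0.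
  have t1 : 4 <= tau * `|k%:~R| :> R by nra.
  by nra.
have -> : m = 0.
  by apply: (small m 1) => //; rewrite mul1r ltr_norml; apply/andP; split; lra.
have -> : n = 0.
  apply: (small n sqrt2); first exact: ltW sqrt2_gt1.
  by rewrite ltr_norml; apply/andP; split; lra.
by rewrite /lattice_point /eigen_point !mulr0 subr0 addr0.
Qed.

Lemma sphere_cover_surj v : exists z, sphere_cover z = v.
Proof.
have [x [y xyv]] := pillow_surj v.
by exists (eigen_point x y); rewrite /sphere_cover eigen_xK eigen_yK.
Qed.

(** Any bound beyond the coordinates of a fundamental domain does; since
[sqrt2 < 2] the eigencoordinates of a point with [|x|, |y| <= tau] are at most
[3 tau]. *)
Definition box : set plane := `[- (4 * tau), 4 * tau] `*` `[- (4 * tau), 4 * tau].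

Lemma box_compact : compact box.
Proof. by apply: compact_setX; exact: segment_compact. Qed.

Lemma box_surj v : exists2 z, box z & sphere_cover z = v.
Proof.
have [z <-] := sphere_cover_surj v.
have [t [m [tI xE]]] := cos_reduce (eigen_x z).
have [u [n [uI yE]]] := cos_reduce (eigen_y z).
have box_pt x y : `|x| <= tau -> `|y| <= tau -> box (eigen_point x y).
  rewrite !ler_norml => /andP[x1 x2] /andP[y1 y2].
  have := sqrt2_gt1; have := sqrt2_lt2 => h1 h2.
  have [y3 y4] : - (2 * tau) <= sqrt2 * y /\ sqrt2 * y <= 2 * tau.
    by have := tau_gt0 (R := R); split; nra.
  by split; rewrite /= in_itv /=; apply/andP; split; lra.
have [x' [x'E x'n]] : exists x', eigen_x z = x' + tau * m%:~R /\ `|x'| <= tau.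
  case/andP: tI => t1 t2; have := tau_gt0 (R := R); rewrite /tau => t3.
  by case: xE => ->; eexists; split; try reflexivity; rewrite ?normrN ger0_norm //; lra.
have [y' [y'E y'n]] : exists y', eigen_y z = y' + tau * n%:~R /\ `|y'| <= tau.
  case/andP: uI => t1 t2; have := tau_gt0 (R := R); rewrite /tau => t3.
  by case: yE => ->; eexists; split; try reflexivity; rewrite ?normrN ger0_norm //; lra.
exists (eigen_point x' y'); first exact: box_pt.
rewrite /sphere_cover eigen_xK eigen_yK x'E y'E.
by apply/pillow_fiber; exists m, n; left.
Qed.

Lemma S2_compact : compact [set: S2 R].
Proof.
rewrite (_ : [set: S2 R] = sphere_cover @` box).
  apply: continuous_compact; last exact: box_compact.
  exact: continuous_subspaceT sphere_cover_continuous.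
by apply/seteqP; split=> // v _; have [z bz <-] := box_surj v; exists z.
Qed.

(** The saturation of [V] is open, and the complement of the image of
[V] is the image of the compact set of the points of the box outside this
saturation. *)
Lemma sphere_cover_open V : open V -> open (sphere_cover @` V).
Proof.
move=> oV; pose sat := sphere_cover @^-1` (sphere_cover @` V).
have oT (h : plane -> plane) : continuous h -> open (h @^-1` V).
  by move=> ch; apply: open_comp => // z _; exact: ch.
have osat : open sat.
  rewrite (_ : sat = \bigcup_(l in lattice)
     ((fun z => z + l) @^-1` V `|` (fun z => l - z) @^-1` V)).
    apply: bigcup_open => l _; apply: openU; apply: oT => z.
      by apply: cvgD; [exact: cvg_id | exact: cvg_cst].
    by apply: cvgB; [exact: cvg_cst | exact: cvg_id].
  apply/seteqP; split=> [z [w Vw /esym/sphere_cover_fiber[h|h]]|z [l Ll [h|h]]].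
  - by exists (w - z) => //; left; rewrite /= subrKC.
  - by exists (w + z) => //; right; rewrite /= addrK.
  - exists (z + l) => //; apply/esym/sphere_cover_fiber; left.
    by rewrite addrAC subrr add0r.
  - exists (l - z) => //; apply/esym/sphere_cover_fiber; right.
    by rewrite subrK.
have -> : sphere_cover @` V = ~` (sphere_cover @` (box `&` ~` sat)).
  apply/seteqP; split=> [v Vv [z [_ nz] zv]|v nv].
    by apply: nz; rewrite /sat /= zv.
  apply: contrapT => nVv; apply: nv; have [z bz zv] := box_surj v.
  by exists z => //; split=> //; rewrite /sat /= zv.
rewrite openC; apply: compact_closed; first exact: metric_hausdorff.
apply: continuous_compact.
  exact: continuous_subspaceT sphere_cover_continuous.
by apply: compact_closedI; [exact: box_compact | exact: open_closedC].
Qed.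

Lemma int_parity (m : int) : exists (k : int) (b : bool), m = 2 * k + b%:Z.
Proof.
have := divz_eq m 2; have := modz_ge0 m (isT : 2 != 0 :> int).
have := ltz_pmod m (isT : 0 < 2 :> int).
case: (m %% 2)%Z => [[|[|//]]|//] _ _ mE; exists (m %/ 2)%Z.
  by exists false; rewrite mulrC.
by exists true; rewrite mulrC.
Qed.

(** A half-lattice point depends on two integers, and its projection
only on their parities: there are four cone points. *)
Lemma sphere_cone_finite : finite_set (sphere_cover @` half_lattice lattice).
Proof.
pose F (b : bool * bool) := sphere_cover
   (eigen_point (pi * (b.1 : nat)%:R) (pi * (b.2 : nat)%:R)).
apply: (@sub_finite_set _ _ (F @` [set: bool * bool])); last first.
  by apply: finite_image; exact: finite_finset.
move=> _ [z [m [n zz]] <-].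
have [k [b mE]] := int_parity m; have [l [d nE]] := int_parity n.
exists (b, d) => //; rewrite /F /sphere_cover eigen_xK eigen_yK /=.
have zx : eigen_x z = pi * m%:~R.
  rewrite -[m%:~R](eigen_xK _ n%:~R).
  have : eigen_x (z + z) = tau * m%:~R by rewrite zz eigen_xK.
  by rewrite /eigen_x /tau /=; lra.
have zy : eigen_y z = pi * n%:~R.
  have : eigen_y (z + z) = tau * n%:~R by rewrite zz eigen_yK.
  have -> : eigen_y (z + z) = 2 * eigen_y z by have h := sqrt2_neq0; rewrite /eigen_y /=; field.
  by rewrite /tau; lra.
apply/pillow_fiber; exists k, l; left; rewrite zx zy mE nE.
by rewrite !intrD !intrM /tau; split; ring.
Qed.

Lemma sphere_flat_cover : flat_cover lattice 1 sphere_cover.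
Proof.
split.
- exact: lattice0.
- exact: latticeB.
- exact: lattice_countable.
- exact: ltr01.
- exact: lattice_gap.
- exact: lattice_irr1.
- exact: lattice_irr2.
- exact: sphere_cover_continuous.
- exact: sphere_cover_surj.
- exact: sphere_cover_open.
- exact: sphere_cover_fiber.
- exact: sphere_cone_finite.
Qed.


Lemma silver_mul : (1 - sqrt2) * (1 + sqrt2) = -1.
Proof. by have := sqrt2_sqr; lra. Qed.

(** On the integer coordinates the diagonal matrix acts as
[(m, n) |-> (m + 2 n, m + n)], an automorphism of determinant [-1]. *)
Lemma lattice_silver v : lattice v -> lattice (diagonal (1 - sqrt2) (1 + sqrt2) v).
Proof.
move=> [m [n ->]]; exists (m + 2 * n), (m + n).
rewrite /lattice_point /eigen_point /diagonal /= !intrD intrM.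
have := congr1 (fun t => t * (tau * n%:~R)) sqrt2_sqr.
by move: sqrt2 tau => w t /= e; congr (_, _); lra.
Qed.

Lemma silver_inv : (1 - sqrt2)^-1 = - (1 + sqrt2) /\ (1 + sqrt2)^-1 = sqrt2 - 1.
Proof.
have s := silver_mul; have b0 : 1 + sqrt2 != 0.
  by rewrite gt_eqF // addr_gt0 // (lt_trans ltr01 sqrt2_gt1).
have a0 : 1 - sqrt2 != 0 by rewrite subr_eq0 eq_sym gt_eqF // sqrt2_gt1.
split; [apply: (mulfI a0) | apply: (mulfI b0)]; rewrite mulfV //; lra.
Qed.

Lemma lattice_silver_inv v : lattice v ->
  lattice (diagonal (1 - sqrt2)^-1 (1 + sqrt2)^-1 v).
Proof.
have [-> ->] := silver_inv.
move=> [m [n ->]]; exists (2 * n - m), (m - n).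
rewrite /lattice_point /eigen_point /diagonal /= !intrB intrM.
have := congr1 (fun t => t * (tau * n%:~R)) sqrt2_sqr.
by move: sqrt2 tau => w t /= e; congr (_, _); lra.
Qed.

End SphereCover.

Theorem theorem5 (R : realType) :
  exists f : homeomorphism (S2 R),
    [/\ @pseudo_anosov R (S2 R) f, cw_expansive f & shadowing f].
Proof.
have pC := @sphere_flat_cover R; have cS := @S2_compact R.
set a : R := 1 - sqrt2; set b : R := 1 + sqrt2.
have s1 := @sqrt2_gt1 R.
have [aV bV] := @silver_inv R.
have a0 : a != 0 by rewrite subr_eq0 eq_sym gt_eqF.
have b1 : 1 < b by rewrite /b; lra.
have b0 : b != 0 by rewrite gt_eqF // (lt_trans ltr01).
have aE : `|a| = b^-1 by rewrite bV ltr0_norm ?opprB // subr_lt0.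
have bE : `|b| = b by rewrite ger0_norm // ltW // (lt_trans ltr01).
have Lab := @lattice_silver R; have Lba := @lattice_silver_inv R.
pose f := Homeomorphism
  (descend_cancel pC (mulVf a0) (mulVf b0) Lba Lab)
  (descend_cancel pC (mulfV a0) (mulfV b0) Lab Lba)
  (descend_continuous (pC := pC) Lab) (descend_continuous (pC := pC) Lba).
have fE z : f (sphere_cover z) = sphere_cover (diagonal a b z) by exact: descendE.
have fVE z : hinv f (sphere_cover z) = sphere_cover (diagonal a^-1 b^-1 z).
  exact: descendE.
have al1 : `|a| < 1 by rewrite aE invf_lt1 // (lt_trans ltr01).
have bl1 : 1 < `|b| by rewrite bE.
exists f; split.
- exact: (cover_pseudo_anosov pC b1 aE bE Lab Lba fE).
- exact: (cover_cw_expansive pC cS al1 a0 bl1 fE fVE).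
- exact: (cover_shadowing pC cS al1 a0 bl1 fE fVE).
Qed.
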